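(* Let $V=V_0+V_1$ satisfy the assumptions in the context. Then for all $f\in L^2(\pi_{ref})$, $$\int_{\mathbb{R}^d}f(x)\,\pi^\epsilon(dx)\longrightarrow\int_{\mathbb{R}^d}f(x)\,\pi^0(dx)\qquad\text{as }\epsilon\to0 .$$
   Context: Fix integers $d,N\ge1$ and $\sigma>0$. $\mathbb{T}^d=\mathbb{R}^d/\mathbb{Z}^d$ is the unit torus (volume $1$); functions on $\mathbb{T}^d$ are identified with $1$-periodic functions on $\mathbb{R}^d$. Assumptions: $V:\mathbb{R}^d\times(\mathbb{T}^d)^N\to\mathbb{R}$ is smooth and $V(x_0,x_1,\ldots,x_N)=V_0(x_0)+V_1(x_0,x_1,\ldots,x_N)$, where $V_0$ is smooth and confining, i.e. $e^{-V_0/\sigma}\in L^1(\mathbb{R}^d)$ and $V_0(x)\to\infty$ as $|x|\to\infty$; $\|\nabla^2V_0\|_{L^\infty(\mathbb{R}^d)}<\infty$; and $V_1$ is smooth and uniformly bounded on $\mathbb{R}^d\times(\mathbb{T}^d)^N$. For $\epsilon>0$ let $V^\epsilon(x)=V(x,x/\epsilon,\ldots,x/\epsilon^N)$. Define probability measures on $\mathbb{R}^d$ through their Lebesgue densities: $$\pi_{ref}(x)=\frac{e^{-V_0(x)/\sigma}}{\int_{\mathbb{R}^d}e^{-V_0/\sigma}},\qquad \pi^\epsilon(x)=\frac{e^{-V^\epsilon(x)/\sigma}}{\int_{\mathbb{R}^d}e^{-V^\epsilon/\sigma}},\qquad \pi^0(x)=\frac{Z(x)}{\int_{\mathbb{R}^d}Z},$$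 where $Z(x)=\int_{(\mathbb{T}^d)^N}e^{-V(x,x_1,\ldots,x_N)/\sigma}\,dx_1\cdots dx_N$. *)

(* Defs.v *)
From HB Require Import structures.
From mathcomp Require Import all_boot all_order all_algebra.
From mathcomp Require Import all_classical all_reals all_analysis.
From mathcomp Require Import measurable_realfun.

Set Implicit Arguments.
Unset Strict Implicit.
Unset Printing Implicit Defensive.

Import Order.TTheory GRing.Theory Num.Theory.
Import numFieldNormedType.Exports.

Local Open Scope classical_set_scope.
Local Open Scope ring_scope.

(* The product sigma-algebra of the coordinates, as for n.-tuple R.  Since R is
   second countable, its members are exactly the Borel sets of 'rV[R]_n. *)
Section measurable_rV.
Context {R : realType} {n : nat}.

Let coor : 'I_n -> 'rV[R]_n -> R := fun i x => x ord0 i.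

Let rV_set0 : g_sigma_preimage coor set0.
Proof. exact: sigma_algebra0. Qed.

Let rV_setC A : g_sigma_preimage coor A -> g_sigma_preimage coor (~` A).
Proof. exact: sigma_algebraC. Qed.

Let rV_bigcup (F : (set 'rV[R]_n)^nat) :
  (forall i, g_sigma_preimage coor (F i)) ->
  g_sigma_preimage coor (\bigcup_i F i).
Proof. exact: sigma_algebra_bigcup. Qed.

HB.instance Definition _ :=
  @isMeasurable.Build (measure_tuple_display default_measure_display)
  'rV[R]_n (g_sigma_preimage coor) rV_set0 rV_setC rV_bigcup.

End measurable_rV.

Section measurable_rV_theory.
Context {R : realType}.

Lemma measurable_coor n (i : 'I_n) :
  measurable_fun [set: 'rV[R]_n] (fun x => x ord0 i).
Proof.
move=> _ Y mY; rewrite setTI; apply: sub_sigma_algebra => /=.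
rewrite -bigcup_seq/=; exists i => /=; first by rewrite mem_index_enum.
by exists Y => //; rewrite setTI.
Qed.

Lemma measurable_fun_coorP d (T : measurableType d) n (f : T -> 'rV[R]_n) :
  measurable_fun [set: T] f <->
  forall i, measurable_fun [set: T] (fun x => f x ord0 i).
Proof.
split=> [mf i|mf]; first exact: (measurableT_comp (measurable_coor i) mf).
apply: (@measurability _ _ _ _ _ _ (\big[setU/set0]_(i < n)
  preimage_set_system setT (fun x : 'rV[R]_n => x ord0 i) measurable)) => //.
move=> _ [B + <-]; case: n => [|n] in f mf B *; first by rewrite big_ord0.
rewrite -bigcup_mkord_ord => -[i _ [A mA <-]].
by rewrite [X in _ `&` X](_ : _ = (fun x => f x ord0 (inord i)) @^-1` A);
  [exact: mf|rewrite setTI].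
Qed.

Definition cons_rV n (p : R * 'rV[R]_n) : 'rV[R]_n.+1 :=
  row_mx (const_mx p.1 : 'rV_1) p.2.

Lemma cons_rV0 n (p : R * 'rV[R]_n) : cons_rV p ord0 ord0 = p.1.
Proof.
rewrite [LHS](_ : _ = row_mx (const_mx p.1 : 'rV_1) p.2 ord0 (lshift n ord0)).
  by rewrite row_mxEl mxE.
by congr (row_mx _ _ _ _); exact: val_inj.
Qed.

Lemma cons_rVS n (p : R * 'rV[R]_n) i : cons_rV p ord0 (lift ord0 i) = p.2 ord0 i.
Proof.
rewrite [LHS](_ : _ = row_mx (const_mx p.1 : 'rV_1) p.2 ord0 (rshift 1 i)).
  by rewrite row_mxEr.
by congr (row_mx _ _ _ _); exact: val_inj.
Qed.

Lemma measurable_cons_rV n : measurable_fun setT (@cons_rV n).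
Proof.
apply/measurable_fun_coorP => i.
rewrite /cons_rV -[n.+1]/(1 + n)%N.
under eq_fun do rewrite mxE.
case: (@fintype.split 1 n i) => j /=.
  under eq_fun do rewrite mxE.
  exact: measurable_fst.
apply: (measurableT_comp (measurable_coor j)); exact: measurable_snd.
Qed.

End measurable_rV_theory.

Section prepend_lebesgue.
Context {R : realType} {n : nat}.
Variable mu : {sigma_finite_measure set 'rV[R]_n -> \bar R}.
Local Open Scope ereal_scope.

Definition prepend_lebesgue : set 'rV[R]_n.+1 -> \bar R :=
  pushforward (lebesgue_measure \x mu) (@cons_rV R n).

Let prepend0 : prepend_lebesgue set0 = 0.
Proof. by rewrite /prepend_lebesgue /pushforward preimage_set0 measure0. Qed.

Let prepend_ge0 A : 0 <= prepend_lebesgue A.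
Proof. by rewrite /prepend_lebesgue /pushforward measure_ge0. Qed.

Let prepend_sigma_additive : semi_sigma_additive prepend_lebesgue.
Proof.
move=> F mF tF mUF; rewrite /prepend_lebesgue /pushforward preimage_bigcup.
apply: measure_semi_sigma_additive.
- by move=> k; rewrite -[X in measurable X]setTI; exact: measurable_cons_rV.
- apply/trivIsetP => /= i j _ _ ij; rewrite -preimage_setI.
  by move/trivIsetP : tF => /(_ _ _ _ _ ij) ->//; rewrite preimage_set0.
- by rewrite -preimage_bigcup -[X in measurable X]setTI;
    exact: measurable_cons_rV.
Qed.

HB.instance Definition _ := isMeasure.Build _ _ _ prepend_lebesgue
  prepend0 prepend_ge0 prepend_sigma_additive.

Let prepend_sigma_finite : sigma_finite setT prepend_lebesgue.
Proof.
have /sigma_finiteP[A [TA ndA Aoo]] := sigma_finiteT (@lebesgue_measure R).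
have /sigma_finiteP[B [TB ndB Boo]] := sigma_finiteT mu.
pose F k := A k `*` B k.
have UF : setT = \bigcup_k F k.
  rewrite -setXTT TA TB predeqE => -[x y]; split.
    move=> [/= [k _ Akx] [l _ Bly]]; exists (maxn k l) => //; split.
    - by move: x Akx; exact/subsetPset/ndA/leq_maxl.
    - by move: y Bly; exact/subsetPset/ndB/leq_maxr.
  by move=> [k _ []/= ? ?]; split; exists k.
have Foo k : measurable (F k) /\ (lebesgue_measure \x mu) (F k) < +oo.
  have [? ?] := Aoo k; have [? ?] := Boo k; split; first exact: measurableX.
  by rewrite product_measure1E// lte_mul_pinfty// ge0_fin_numE.
pose g (x : 'rV[R]_n.+1) : R * 'rV[R]_n :=
  (x ord0 ord0, rsubmx (x : 'rV_(1 + n))).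
have mg : measurable_fun setT g.
  apply: measurable_fun_pair; first exact: measurable_coor.
  apply/measurable_fun_coorP => i; under eq_fun do rewrite mxE.
  exact: measurable_coor.
have gK : cancel (@cons_rV R n) g.
  by move=> [x v]; rewrite /g cons_rV0 /cons_rV row_mxKr.
exists (fun i => g @^-1` F i).
  by rewrite -preimage_bigcup -UF preimage_setT.
move=> i; have [mF Fi] := Foo i; split.
  by rewrite -[X in measurable X]setTI; exact: mg.
rewrite /prepend_lebesgue /pushforward -comp_preimage.
by rewrite (_ : g \o _ = id)//; apply/funext => p /=; rewrite gK.
Qed.

HB.instance Definition _ := Measure_isSigmaFinite.Build _ _ _ prepend_lebesgue
  prepend_sigma_finite.

End prepend_lebesgue.

Fixpoint lebesgue_rV {R : realType} (n : nat) :
    {sigma_finite_measure set 'rV[R]_n -> \bar R} :=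
  match n with
  | 0 => \d_ (0 : 'rV[R]_0)
  | n'.+1 => prepend_lebesgue (lebesgue_rV n')
  end.

Lemma lebesgue_rV_box {R : realType} n (A : 'I_n -> set R) :
  (forall i, measurable (A i)) ->
  lebesgue_rV n [set x | forall i, A i (x ord0 i)] =
  (\prod_(i < n) lebesgue_measure (A i))%E.
Proof.
elim: n A => [|n ih] A mA.
  by rewrite big_ord0 /= diracE mem_set// => -[].
rewrite big_ord_recl -ih// -product_measure1E//; [|exact: mA|]; last first.
  rewrite [X in measurable X](_ : _ =
    \bigcap_(i in [set: 'I_n]) (fun x : 'rV[R]_n => x ord0 i) @^-1`
      A (lift ord0 i)); last by apply/seteqP; split=> [x h i _|x h i]; exact: h.
  apply: fin_bigcap_measurable => // i _.
  by rewrite -[X in measurable X]setTI; exact: measurable_coor.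
rewrite /= /prepend_lebesgue /pushforward.
congr ((lebesgue_measure \x _)%E _); apply/seteqP; split=> -[x v] /=.
  move=> h; split=> [|i].
    by have := h ord0; rewrite cons_rV0.
  by have := h (lift ord0 i); rewrite cons_rVS.
move=> [h0 h] i; case: (unliftP ord0 i) => [j|] ->; rewrite ?cons_rV0//.
by rewrite cons_rVS; exact: h.
Qed.

(* The measure of density p with respect to mu; the zero measure when p is not
   a measurable nonnegative function, so that it is a measure for every p. *)
Section density_measure.
Context d (T : measurableType d) (R : realType).
Variables (mu : {measure set T -> \bar R}) (p : T -> R).
Local Open Scope ereal_scope.

Definition density_measure (A : set T) : \bar R :=
  if `[< measurable_fun setT p /\ (forall x, 0 <= p x)%R >]
  then \int[mu]_(x in A) (p x)%:E else 0.

Let density0 : density_measure set0 = 0.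
Proof. by rewrite /density_measure; case: ifP => // _; exact: integral_set0. Qed.

Let density_ge0 A : 0 <= density_measure A.
Proof.
rewrite /density_measure; case: ifP => // /asboolP[_ p0].
by apply: integral_ge0 => x _; rewrite lee_fin.
Qed.

Let density_sigma_additive : semi_sigma_additive density_measure.
Proof.
move=> F mF tF mUF; rewrite /density_measure; case: ifP => [|_]; last first.
  by under eq_fun do rewrite big1//; exact: cvg_cst.
move=> /asboolP[mp p0]; rewrite ge0_integral_bigcup//=; first last.
- by move=> x _; rewrite lee_fin.
- by apply/measurable_EFinP; exact: measurable_funTS.
apply: is_cvg_ereal_nneg_natsum_cond => n _ _.
by apply: integral_ge0 => x _; rewrite lee_fin.
Qed.

HB.instance Definition _ := isMeasure.Build _ _ _ density_measure
  density0 density_ge0 density_sigma_additive.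

Lemma density_measureE A : measurable_fun setT p -> (forall x, 0 <= p x)%R ->
  density_measure A = \int[mu]_(x in A) (p x)%:E.
Proof. by move=> mp p0; rewrite /density_measure asboolT. Qed.

End density_measure.

Section smooth.
Context {R : realType} {U : normedModType R}.

(* Class C^k: on a finite-dimensional U, the differential of f is of class C^k
   iff all the directional derivatives of f are. *)
Fixpoint classC (k : nat) (f : U -> R) : Prop :=
  match k with
  | 0 => continuous f
  | k'.+1 => (forall x, differentiable f x) /\ forall v, classC k' ('D_v f)
  end.

Definition smooth (f : U -> R) : Prop := forall k, classC k f.

End smooth.

Section potential.
Context {R : realType} {d N : nat}.
Local Notation Rd := ('rV[R]_d).
Local Notation RNd := ('M[R]_(N, d)).
Implicit Types (U : Rd -> R) (V : Rd * RNd -> R) (sigma eps : R).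

(* `|x| is the sup norm, equivalent to the Euclidean one; likewise below for
   the norm of the Hessian. *)
Definition confining U sigma : Prop :=
  (lebesgue_rV d).-integrable setT (fun x => (expR (- U x / sigma))%:E) /\
  forall M : R, \forall r \near +oo, forall x : Rd, r <= `|x| -> M <= U x.

Definition hessian U (x : Rd) : 'M[R]_d :=
  \matrix_(i, j) 'D_(delta_mx ord0 i) ('D_(delta_mx ord0 j) U) x.

(* A function on R^d x (T^d)^N is represented by its lift to R^d x (R^d)^N,
   the k-th row of the second component being the k-th torus variable. *)
Definition torus_periodic V : Prop :=
  forall (x : Rd) (y : RNd) (z : 'M[int]_(N, d)),
    V (x, y + map_mx intr z) = V (x, y).

Definition multiscale V eps (x : Rd) : R :=
  V (x, \matrix_(k < N, j < d) (x ord0 j / eps ^+ k.+1)).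

(* Integration over the torus (T^d)^N is integration of the lift over the
   fundamental domain [0, 1)^(N * d). *)
Definition torus_weight V sigma (x : Rd) : R :=
  \int[lebesgue_rV (N * d)]_(y in [set y | forall i, y ord0 i \in `[0, 1[])
    expR (- V (x, vec_mx y) / sigma).

(* The probability measure with Lebesgue density proportional to w. *)
Definition prob_of_weight (w : Rd -> R) : {measure set Rd -> \bar R} :=
  density_measure (lebesgue_rV d)
    (fun x => w x / \int[lebesgue_rV d]_y w y).

Lemma prob_of_weight_setT (w : Rd -> R) :
  measurable_fun setT w -> (forall x, 0 <= w x) ->
  (lebesgue_rV d).-integrable setT (EFin \o w) ->
  0 < \int[lebesgue_rV d]_y w y ->
  prob_of_weight w setT = 1%E.
Proof.
move=> mw w0 iw c0; set c := (X in 0 < X) in c0.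
rewrite /prob_of_weight /= density_measureE -/c; last first.
- by move=> x; rewrite divr_ge0// ltW.
- exact: measurable_funM.
under eq_integral do rewrite mulrC EFinM.
rewrite integralZl//= -[X in (_ * X)%E]fineK ?integrable_fin_num//.
by rewrite -EFinM mulVf// gt_eqF.
Qed.

Definition pi_ref U sigma := prob_of_weight (fun x => expR (- U x / sigma)).

Definition pi_eps V sigma eps :=
  prob_of_weight (fun x => expR (- multiscale V eps x / sigma)).

Definition pi_zero V sigma := prob_of_weight (torus_weight V sigma).

End potential.

(* Main.v *)
(* Let h(s) = eps s_1 + ... + eps^N s_N with s in the torus (T^d)^N.  Replacing
   x by x + h(s) does not change the Lebesgue integral of G(x, x/eps, ...,
   x/eps^N), and it moves the k-th fast variable to x/eps^k + s_k + (a linear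
   combination of s_1, ..., s_(k-1)) + O(eps).  When G is continuous, periodic
   in the fast variables and compactly supported in x, uniform continuity
   removes h(s) and the O(eps) term; averaging over s then leaves a measure
   preserving triangular map of the torus, so the integral converges to that of
   the torus average of G.  Since the weights exp(-V_1/sigma) are bounded above
   and away from 0, this extends from continuous compactly supported test
   functions to L^1(pi_ref), which contains L^2(pi_ref), by a Dynkin class
   argument, and the expectations under pi^eps and pi^0 are quotients of such
   integrals. *)

Require Import Defs.
From mathcomp Require Import all_boot all_order all_algebra.
From mathcomp Require Import all_classical all_reals all_analysis.
From mathcomp Require Import measurable_realfun ring lra.

Set Implicit Arguments.
Unset Strict Implicit.
Unset Printing Implicit Defensive.

Import Order.TTheory GRing.Theory Num.Theory.
Import numFieldNormedType.Exports.

Local Open Scope classical_set_scope.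
Local Open Scope ring_scope.

(** * Measurability and translation invariance on R^n *)

Section measurability.
Context {R : realType}.

Lemma measurable_rV_coor_set n (i : 'I_n) (B : set R) :
  measurable B -> measurable [set x : 'rV[R]_n | B (x ord0 i)].
Proof.
move=> mB; rewrite -[X in measurable X]setTI; exact: (measurable_coor i).
Qed.

Lemma measurable_rV_box n (B : 'I_n -> set R) :
  (forall i, measurable (B i)) ->
  measurable [set x : 'rV[R]_n | forall i, B i (x ord0 i)].
Proof.
move=> mB; rewrite [X in measurable X](_ : _ =
    \bigcap_(i in [set: 'I_n]) [set x : 'rV[R]_n | B i (x ord0 i)]).
  apply: fin_bigcap_measurable => // i _; exact: measurable_rV_coor_set.
by apply/seteqP; split => [x h i _|x h i]; exact: h.
Qed.

(** The sigma-algebra is generated by the coordinates, so an open set is exhibited as a countable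
    union of rational boxes. *)
Lemma open_measurable_rV n (A : set 'rV[R]_n) : open A -> measurable A.
Proof.
move=> oA.
pose box (p : 'rV[rat]_n * nat) := [set x : 'rV[R]_n |
  forall i, `](ratr (p.1 ord0 i) - p.2.+1%:R^-1),
              (ratr (p.1 ord0 i) + p.2.+1%:R^-1)[%classic (x ord0 i)].
(* The set indexed by [p] is [box p] when that box lies in [A] and empty otherwise, so the union
   runs over a whole countable type. *)
rewrite (_ : A = \bigcup_p [set x | box p `<=` A /\ box p x]).
  apply: (@countable_bigcupT_measurable _ _ _ (fun p =>
    [set x | box p `<=` A /\ box p x])) => [|p].
    exact: countableP.
  have [h|h] := pselect (box p `<=` A).
    rewrite [X in measurable X](_ : _ = box p).
      apply: (@measurable_rV_box _ (fun i =>
        `](ratr (p.1 ord0 i) - p.2.+1%:R^-1),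
          (ratr (p.1 ord0 i) + p.2.+1%:R^-1)[%classic)) => i.
      exact: measurable_itv.
    by apply/seteqP; split => x //= [].
  rewrite [X in measurable X](_ : _ = set0) //.
  by apply/seteqP; split => x //= [].
apply/seteqP; split => [x Ax|x [p _ [h bx]]]; last exact: h.
move: oA; rewrite openE => /(_ _ Ax) /nbhs_ballP[e /= e0 eA].
(* A radius 1/(k+1) below e/2 and a rational centre within that radius of [x] keep the whole box
   inside the ball of radius e. *)
have e20 : 0 < e / 2 by rewrite divr_gt0.
have [k _ /(_ k (leqnn _)) /= ke] := near_infty_natSinv_lt (PosNum e20).
have k0 : 0 < k.+1%:R^-1 :> R by rewrite invr_gt0.
set r := fun k : nat => k.+1%:R^-1 : R; rewrite -/(r k) in ke k0 *.
have q (i : 'I_n) : {q : rat | x ord0 i - r k < ratr q < x ord0 i + r k}.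
  apply: cid; have [|q] := @rat_in_itvoo R (x ord0 i - r k) (x ord0 i + r k).
    by lra.
  by rewrite in_itv /=; exists q.
exists (\row_i sval (q i), k) => //; split.
  move=> y /= yb; apply: eA; split => // i j.
  rewrite !ord1; have := yb j; rewrite /= in_itv /= mxE.
  case: (q j) => qj /= ?; rewrite /ball /= ltr_norml -/(r k); move: ke => /=;
    lra.
by move=> i /=; rewrite in_itv /= mxE; case: (q i) => qi /=; rewrite -/(r k);
  lra.
Qed.

Lemma continuous_measurable_rV n (c : 'rV[R]_n -> R) :
  continuous c -> measurable_fun setT c.
Proof.
move=> /continuousP cc; apply: (measurability _ (RGenOpens.measurableE R)).
move=> _ [_ [a [b ->] <-]]; rewrite setTI.
by apply: open_measurable_rV; apply: cc; exact: interval_open.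
Qed.

Lemma cvg_mx_coor m n (T : Type) (F : set_system T) (FF : Filter F)
    (f : T -> 'M[R]_(m, n)) (l : 'M[R]_(m, n)) :
  (forall i j, f x i j @[x --> F] --> l i j) -> f @ F --> l.
Proof.
move=> h; apply/cvg_ballP => e e0.
have : \forall x \near F, forall i j, ball (l i j) e (f x i j).
  apply: filter_forall => i; apply: filter_forall => j.
  by move/cvg_ballP : (h i j); exact.
by apply: filterS => x hx; split.
Qed.

(** Concatenation identifies a pair with one row vector, where continuity already gives
    measurability; this reconciles the product topology with the product sigma-algebra. *)
Lemma continuous_measurable_rV_pair m n (c : 'rV[R]_m * 'rV[R]_n -> R) :
  continuous c -> measurable_fun setT c.
Proof.
move=> cc.
pose g (z : 'rV[R]_(m + n)) := (lsubmx z, rsubmx z).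
have cg : continuous g.
  move=> z; have hl : lsubmx y @[y --> z] --> lsubmx z.
    by apply: (cvg_mx_coor (nbhs_filter z)) => i j; under eq_fun do rewrite mxE;
      rewrite mxE; exact: coord_continuous.
  have hr : rsubmx y @[y --> z] --> rsubmx z.
    by apply: (cvg_mx_coor (nbhs_filter z)) => i j; under eq_fun do rewrite mxE;
      rewrite mxE; exact: coord_continuous.
  exact: (cvg_pair hl hr).
have mcg : measurable_fun setT (c \o g).
  by apply: continuous_measurable_rV => z; apply: continuous_comp;
    [exact: cg|exact: cc].
rewrite (_ : c = (c \o g) \o (fun p => row_mx p.1 p.2)); last first.
  by apply/funext => -[x y] /=; rewrite /g row_mxKl row_mxKr.
apply: (measurableT_comp mcg); apply/measurable_fun_coorP => i.
under eq_fun do rewrite mxE.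
case: (fintype.split i) => j.
  exact: (measurableT_comp (measurable_coor j) measurable_fst).
exact: (measurableT_comp (measurable_coor j) measurable_snd).
Qed.

End measurability.

Section translation.
Context {R : realType}.
Local Open Scope ereal_scope.

(** The translated measure agrees with Lebesgue measure on half-open intervals, and these determine
    it. *)
Lemma lebesgue_measure_shift (h : R) (A : set R) : measurable A ->
  lebesgue_measure A = lebesgue_measure [set x | A (x + h)%R].
Proof.
have mh : measurable_fun setT
    (fun x : measurableTypeR R => (x + h)%R : measurableTypeR R).
  exact: measurable_funD.
(* The instance is named because it takes the measurability proof [mh]. *)
move: A; apply: (@lebesgue_measure_unique R
  (measure_function_pushforward__canonical__measure_function_Measure
    lebesgue_measure mh)).
move=> _ [[a b] _ <-] /=.
rewrite /pushforward [X in _ = _ X](_ : _ = `](a - h)%R, (b - h)%R]%classic);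
  last first.
  by apply/seteqP; split => x /=; rewrite !in_itv /=; lra.
rewrite !lebesgue_measure_itv /= !lte_fin ltrD2r.
by case: ifP => // _; rewrite -!EFinB; congr EFin; ring.
Qed.

Lemma ge0_integral_shift (h : R) (F : R -> \bar R) :
  measurable_fun setT F -> (forall x, 0 <= F x) ->
  \int[lebesgue_measure]_x F (x + h)%R = \int[lebesgue_measure]_x F x.
Proof.
move=> mF F0.
have mh : measurable_fun setT
    (fun x : measurableTypeR R => (x + h)%R : measurableTypeR R).
  exact: measurable_funD.
rewrite [RHS](eq_measure_integral (pushforward lebesgue_measure
  (fun x : measurableTypeR R => (x + h)%R : measurableTypeR R))); last first.
  by move=> A mA _; exact: lebesgue_measure_shift.
by rewrite ge0_integral_pushforward.
Qed.

Lemma ge0_integral_rVS n (F : 'rV[R]_n.+1 -> \bar R) :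
  measurable_fun setT F -> (forall x, 0 <= F x) ->
  \int[lebesgue_rV n.+1]_x F x =
  \int[lebesgue_measure]_t \int[lebesgue_rV n]_u F (cons_rV (t, u)).
Proof.
move=> mF F0; rewrite /= /prepend_lebesgue ge0_integral_pushforward //.
  rewrite preimage_setT.
  rewrite fubini_tonelli1 //=.
  apply: measurableT_comp => //; exact: measurable_cons_rV.
exact: measurable_cons_rV.
Qed.

Lemma measurable_cons_rVr n (t : R) :
  measurable_fun setT (fun u : 'rV[R]_n => cons_rV (t, u)).
Proof.
apply: (measurableT_comp (@measurable_cons_rV R n)); exact: measurable_fun_pair.
Qed.

Lemma rV_consE n (x : 'rV[R]_n.+1) : exists t u, x = cons_rV (t, u).
Proof.
exists (x ord0 ord0), (\row_i x ord0 (lift ord0 i)); apply/rowP => i.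
by case: (unliftP ord0 i) => [j|] ->; rewrite ?cons_rV0 ?cons_rVS ?mxE.
Qed.

Lemma cons_rVD n (t t' : R) (u u' : 'rV[R]_n) :
  (cons_rV (t, u) + cons_rV (t', u') = cons_rV ((t + t')%R, (u + u')))%R.
Proof.
apply/rowP => i; rewrite mxE.
by case: (unliftP ord0 i) => [j|] ->; rewrite ?cons_rV0 ?cons_rVS ?mxE.
Qed.

Lemma measurable_rV_shift n (h : 'rV[R]_n) :
  measurable_fun setT (fun x : 'rV[R]_n => (x + h)%R).
Proof.
apply/measurable_fun_coorP => i; under eq_fun do rewrite mxE.
by apply: measurable_funD => //; exact: measurable_coor.
Qed.

(** Induction on the dimension: for a fixed first coordinate the inner integral absorbs the shift of
    the others, then the one-dimensional case absorbs that of the first. *)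
Lemma ge0_integral_rV_shift n (h : 'rV[R]_n) (F : 'rV[R]_n -> \bar R) :
  measurable_fun setT F -> (forall x, 0 <= F x) ->
  \int[lebesgue_rV n]_x F (x + h)%R = \int[lebesgue_rV n]_x F x.
Proof.
elim: n h F => [|n ih] h F mF F0.
  by apply: eq_integral => x _; congr F; apply/rowP => -[].
have [a [b ->]] := rV_consE h.
rewrite !ge0_integral_rVS //; last first.
  by apply: measurableT_comp => //; exact: measurable_rV_shift.
under eq_integral => t _.
  under eq_integral => u _ do rewrite cons_rVD.
  rewrite (ih b (fun u => F (cons_rV ((t + a)%R, u)))) //; last first.
    exact: (measurableT_comp mF (@measurable_cons_rVr n _)).
  over.
rewrite (ge0_integral_shift a (F := fun t =>
  \int[lebesgue_rV n]_u F (cons_rV (t, u)))) //.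
- apply: (measurable_fun_fubini_tonelli_F (F \o @cons_rV R n)) => //.
  by apply: measurableT_comp => //; exact: measurable_cons_rV.
- by move=> t; exact: F0.
- by move=> t; apply: integral_ge0 => u _; exact: F0.
Qed.

End translation.

(** * Triangular shifts of the torus *)

Definition unit_cube {R : realType} {n : nat} : set 'rV[R]_n :=
  [set y | forall i, y ord0 i \in `[0, 1[].

(** Such an [a] makes [y + a y] a skew product: each coordinate is translated by an amount fixed by
    the earlier ones. *)
Definition triangular {R : realType} n (a : 'rV[R]_n -> 'rV[R]_n) :=
  forall (i : 'I_n) (y y' : 'rV[R]_n),
  (forall j : 'I_n, (j < i)%N -> y ord0 j = y' ord0 j) ->
  a y ord0 i = a y' ord0 i.

Section torus.
Context {R : realType}.
Local Open Scope ereal_scope.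

Lemma measurable_unit_cube n : measurable (@unit_cube R n).
Proof.
apply: (@measurable_rV_box _ _ (fun=> `[0%R, 1%R[%classic)) => i.
exact: measurable_itv.
Qed.

Lemma lebesgue_rV_unit_cube n : lebesgue_rV n (@unit_cube R n) = 1.
Proof.
rewrite (lebesgue_rV_box (A := fun=> `[0%R, 1%R[%classic)) => [|i]; last first.
  exact: measurable_itv.
by apply: big1 => i _;
  rewrite lebesgue_measure_itv /= lte_fin ltr01 oppr0 adde0.
Qed.

Lemma ge0_integral_itv_shift (x y b : R) (H : R -> \bar R) :
  measurable_fun setT H -> (forall t, 0 <= H t) ->
  \int[lebesgue_measure]_(t in `[x, y[) H (t + b)%R =
  \int[lebesgue_measure]_(t in `[(x + b)%R, (y + b)%R[) H t.
Proof.
move=> mH H0; rewrite integral_mkcond [RHS]integral_mkcond.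
rewrite -[RHS](@ge0_integral_shift _ b).
- apply: eq_integral => t _; rewrite /patch !mem_setE !in_itv /=.
  by rewrite lerD2r ltrD2r.
- by apply/(measurable_restrictT _ _).1 => //; exact: measurable_funTS.
- by move=> t; apply: erestrict_ge0 => ? _; exact: H0.
Qed.

Lemma ge0_integral_itvU (x y z : R) (H : R -> \bar R) :
  measurable_fun setT H -> (forall t, 0 <= H t) -> (x <= y <= z)%R ->
  \int[lebesgue_measure]_(t in `[x, z[) H t =
  \int[lebesgue_measure]_(t in `[x, y[) H t +
  \int[lebesgue_measure]_(t in `[y, z[) H t.
Proof.
move=> mH H0 /andP[xy yz]; rewrite -ge0_integral_setU //.
- congr integral; apply/seteqP; split => t /=; rewrite !in_itv /=.
    by move=> /andP[xt tz]; case: (ltP t y) => ty; [left|right]; rewrite ?xt.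
  by move=> [/andP[xt ty]|/andP[yt tz]]; apply/andP; split => //; lra.
- exact: measurable_funTS.
- by apply/disj_setPS => t /= []; rewrite !in_itv /=; lra.
Qed.

(** Periodicity replaces [a] by its fractional part [b]; the window [b, 1 + b) is then cut at 1 and
    its right piece moved back to [0, b). *)
Lemma ge0_integral_circle_shift (a : R) (H : R -> \bar R) :
  measurable_fun setT H -> (forall t, 0 <= H t) ->
  (forall t (z : int), H (t + z%:~R)%R = H t) ->
  \int[lebesgue_measure]_(t in `[0%R, 1%R[) H (t + a)%R =
  \int[lebesgue_measure]_(t in `[0%R, 1%R[) H t.
Proof.
move=> mH H0 Hper; pose b := (a - (Num.floor a)%:~R)%R.
have b01 : (0 <= b <= 1)%R.
  have := floor_itv a; rewrite /b intrD; lra.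
transitivity (\int[lebesgue_measure]_(t in `[0%R, 1%R[) H (t + b)%R).
  by apply: eq_integral => t _;
    rewrite -(Hper (t + b)%R (Num.floor a)) /b addrA subrK.
rewrite ge0_integral_itv_shift // add0r (@ge0_integral_itvU b 1%R) //; last lra.
rewrite [RHS](@ge0_integral_itvU _ b) // addeC; congr (_ + _).
rewrite -{1}[1%R]add0r [(1 + b)%R]addrC -ge0_integral_itv_shift //.
by apply: eq_integral => t _; rewrite -[RHS](Hper t 1%R).
Qed.

Lemma ge0_integral_unit_cubeS n (F : 'rV[R]_n.+1 -> \bar R) :
  measurable_fun setT F -> (forall x, 0 <= F x) ->
  \int[lebesgue_rV n.+1]_(y in unit_cube) F y =
  \int[lebesgue_measure]_(t in `[0%R, 1%R[)
    \int[lebesgue_rV n]_(u in unit_cube) F (cons_rV (t, u)).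
Proof.
move=> mF F0; rewrite integral_mkcond ge0_integral_rVS.
- rewrite [RHS]integral_mkcond; apply: eq_integral => t _.
  rewrite /patch; case: ifPn => [|/negP] t01; rewrite mem_setE in t01.
    rewrite [RHS]integral_mkcond; apply: eq_integral => u _; rewrite /patch.
    congr (if _ then _ else _); apply/idP/idP => /set_mem cu; apply/mem_set =>
      i.
      by have := cu (lift ord0 i); rewrite cons_rVS.
    by case: (unliftP ord0 i) => [j|] ->; rewrite ?cons_rV0 ?cons_rVS //;
      exact: cu.
  apply: integral0_eq => u _; rewrite ifF //; apply/negP => /set_mem /(_ ord0).
  by rewrite cons_rV0.
- by apply/(measurable_restrictT _ _).1;
    [exact: measurable_unit_cube|exact: measurable_funTS].
- by move=> t; apply: erestrict_ge0 => ? _; exact: F0.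
Qed.

Lemma measurable_integral_unit_cube n (F : 'rV[R]_n.+1 -> \bar R) :
  measurable_fun setT F -> (forall x, 0 <= F x) ->
  measurable_fun setT
    (fun t => \int[lebesgue_rV n]_(u in unit_cube) F (cons_rV (t, u))).
Proof.
move=> mF F0.
under eq_fun do rewrite integral_mkcond.
pose G (p : R * 'rV[R]_n) := if p.2 \in unit_cube then F (cons_rV p) else 0.
apply: (measurable_fun_fubini_tonelli_F (G : measurableTypeR R * 'rV[R]_n ->
  \bar R)).
- rewrite (_ : G = (F \o cons_rV (n:=n)) \_ [set p | unit_cube p.2]).
    apply/(measurable_restrictT _ _).1.
      rewrite -[X in measurable X]setTI; apply: measurable_snd => //.
      exact: measurable_unit_cube.
    by apply: measurable_funTS; apply: measurableT_comp => //;
      exact: measurable_cons_rV.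
  by apply/funext => p; rewrite /G /patch.
- by move=> p; rewrite /G; case: ifP.
Qed.

(** Periodicity is stated for integer rows; the [oapp] expression is the integer row with head [k]
    and tail [z]. *)
Lemma cons_rVDz n (t : R) (u : 'rV[R]_n) (k : int) (z : 'rV[int]_n) :
  (cons_rV (t + k%:~R, u + map_mx intr z) = cons_rV (t, u) +
   map_mx intr (\row_i oapp (fun j => z ord0 j) k (unlift ord0 i)))%R.
Proof.
apply/rowP => i; rewrite [RHS]mxE; case: (unliftP ord0 i) => [j|] ->.
  by rewrite !cons_rVS !mxE liftK.
by rewrite !cons_rV0 !mxE unlift_none.
Qed.

(** Induction on the dimension. The first displacement is a constant [alpha]; once the first
    coordinate is fixed, the rest of [a] is triangular in the others, so the inner integral forgets
    it. What remains is the shift by [alpha] of a 1-periodic function on the circle. *)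
Lemma ge0_integral_torus_shift n (a : 'rV[R]_n -> 'rV[R]_n)
    (psi : 'rV[R]_n -> \bar R) :
  measurable_fun setT a -> triangular a ->
  measurable_fun setT psi -> (forall y, 0 <= psi y) ->
  (forall y (z : 'rV[int]_n), psi (y + map_mx intr z)%R = psi y) ->
  \int[lebesgue_rV n]_(y in unit_cube) psi (y + a y)%R =
  \int[lebesgue_rV n]_(y in unit_cube) psi y.
Proof.
elim: n a psi => [|n ih] a psi ma ta mpsi psi0 per.
  by apply: eq_integral => y _; congr psi; apply/rowP => -[].
pose b (t : R) (u : 'rV[R]_n) : 'rV[R]_n := \row_i a (cons_rV (t, u)) ord0
  (lift ord0 i).
(* No index precedes the first one, so triangularity makes this coordinate the same at every
   point. *)
pose alpha := a 0%R ord0 ord0.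
have aE t u : a (cons_rV (t, u)) = cons_rV (alpha, b t u).
  apply/rowP => i; case: (unliftP ord0 i) => [j|] ->;
    rewrite ?cons_rV0 ?cons_rVS ?mxE //=.
  by apply: ta => j; rewrite ltn0.
rewrite !ge0_integral_unit_cubeS //; last first.
  apply: measurableT_comp => //; apply/measurable_fun_coorP => i.
  under eq_fun do rewrite mxE.
  by apply: measurable_funD;
    [exact: measurable_coor|exact: (measurableT_comp (measurable_coor i) ma)].
pose H t := \int[lebesgue_rV n]_(u in unit_cube) psi (cons_rV (t, u)).
transitivity (\int[lebesgue_measure]_(t in `[0%R, 1%R[) H (t + alpha)%R).
  apply: eq_integral => t _.
  under eq_integral => u _ do rewrite aE cons_rVD.
  apply: (ih (b t) (fun u => psi (cons_rV ((t + alpha)%R, u)))) => //.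
  - apply/measurable_fun_coorP => i; under eq_fun do rewrite mxE.
    apply: (measurableT_comp (measurable_coor _)); apply: measurableT_comp =>
      //.
    exact: measurable_cons_rVr.
  - move=> i y y' yy'; rewrite !mxE; apply: ta => j.
    case: (unliftP ord0 j) => [k|] ->; rewrite ?cons_rV0 ?cons_rVS //= => ki.
    by apply: yy'.
  - exact: (measurableT_comp mpsi (@measurable_cons_rVr _ n _)).
  - by move=> y z;
      rewrite -[(t + alpha)%R in LHS](addr0 _) -[0%R in LHS]/(0%:~R) cons_rVDz
        per.
apply: ge0_integral_circle_shift.
- exact: measurable_integral_unit_cube.
- by move=> t; apply: integral_ge0 => u _; exact: psi0.
- move=> t z; apply: eq_integral => u _.
  by rewrite -[u in LHS]addr0 -[0%R in LHS](map_mx0 intr) cons_rVDz per.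
Qed.

End torus.

(** * From test functions to L^1 *)

Lemma integrable_cst_fin d (T : measurableType d) (R : realType)
    (mu : {measure set T -> \bar R}) (D : set T) (K : R) :
  measurable D -> mu D \is a fin_num -> mu.-integrable D (EFin \o cst K).
Proof.
move=> mD muD; apply/integrableP; split=> /=.
  by apply/measurable_EFinP; exact: measurable_cst.
rewrite (eq_integral (cst `|K|%:E)) // integral_cst // ltey_eq.
by rewrite fin_numM.
Qed.

Section weak_star.
Context {R : realType} {d : nat}.
Variables (nu : {measure set 'rV[R]_d -> \bar R}) (psi : R -> 'rV[R]_d -> R).
Variable C : R.
Hypothesis nu_fin : nu setT \is a fin_num.
Hypothesis mpsi : forall e, measurable_fun setT (psi e).
Hypothesis psiC : forall e x, `|psi e x| <= C.

Let int (f : 'rV[R]_d -> R) := nu.-integrable setT (EFin \o f).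

(** Weak-star convergence of [psi e] to 0, tested against [f]. *)
Let null f := int f /\ (\int[nu]_x (f x * psi e x)) @[e --> 0^'+] --> (0 : R).

Lemma integrable_mul_psi f e : int f -> int (fun x => f x * psi e x).
Proof.
move=> fi; apply: (@le_integrable _ _ _ _ _ _ _ (fun x => C%:E * (f x)%:E)%E) =>
  //.
- apply/measurable_EFinP; apply: measurable_funM => //.
  by apply/measurable_EFinP; exact: measurable_int fi.
- move=> x _ /=; rewrite lee_fin normrM normrM mulrC ler_wpM2r //.
  by rewrite (le_trans (psiC e x)) // ler_norm.
- exact: integrableZl.
Qed.

Lemma null_lin (a b : R) f g : null f -> null g ->
  null (fun x => a * f x + b * g x).
Proof.
move=> [fi f0] [gi g0].
have Zi c h : int h -> int (fun x => c * h x) by move=> hi;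
  exact: (integrableZl measurableT c hi).
split.
  exact: (integrableD measurableT (Zi a f fi) (Zi b g gi)).
rewrite (_ : (fun e => _) = (fun e => a * (\int[nu]_x (f x * psi e x)) + b *
  (\int[nu]_x (g x * psi e x)))).
  rewrite -[X in _ --> X](_ : a * 0 + b * 0 = 0); last by rewrite !mulr0 addr0.
  by apply: cvgD; apply: cvgZr.
apply/funext => e.
have fe := integrable_mul_psi e fi; have ge := integrable_mul_psi e gi.
rewrite -RintegralZl // -RintegralZl // -RintegralD //; [|exact: Zi|exact: Zi].
by apply: eq_Rintegral => x _; ring.
Qed.

(** Since [psi] is bounded by [C] uniformly in e, replacing [f] by [f_ n] costs at most [C] times
    their L^1 distance, whatever e is. *)
Lemma null_L1_lim (f_ : nat -> 'rV[R]_d -> R) f : (forall n, null (f_ n)) ->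
  int f ->
  (\int[nu]_x `|(f_ n x - f x)%:E|)%E @[n --> \oo] --> 0%E -> null f.
Proof.
move=> nf fi /fine_cvgP[_ f0]; split => //.
have C0 : 0 <= C by rewrite (le_trans _ (psiC 0 0)).
(* [C] may vanish, so the tolerance is divided by [C + 1]. *)
have C1 : 0 < C + 1 by lra.
apply/cvgr0Pnorm_le => e e0.
have ee : 0 < e / 2 / (C + 1) by rewrite !divr_gt0.
have [n _ /(_ n (leqnn _)) /=] := cvgr0_norm_le _ f0 _ ee.
move=> ne; have [fni fn0] := nf n.
near=> t.
have te : `|\int[nu]_x (f_ n x * psi t x)| <= e / 2.
  by near: t; apply: cvgr0_norm_le => //; rewrite divr_gt0.
have fit := integrable_mul_psi t fi; have fnt := integrable_mul_psi t fni.
have di : int (fun x => f_ n x - f x) by exact: (integrableB measurableT fni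
  fi).
have dt := integrable_mul_psi t di.
have -> : \int[nu]_x (f x * psi t x) = \int[nu]_x (f_ n x * psi t x) -
  \int[nu]_x ((f_ n x - f x) * psi t x).
  by rewrite -RintegralB //; apply: eq_Rintegral => x _; ring.
rewrite (le_trans (ler_normB _ _)) // [e]splitr lerD //.
rewrite (le_trans (le_normr_Rintegral _ _)) //.
have dC : int (fun x => (C + 1) * `|f_ n x - f x|).
  by exact: (integrableZl measurableT (C + 1) (integrable_norm di)).
apply: (@le_trans _ _ (\int[nu]_x ((C + 1) * `|f_ n x - f x|))).
  apply: le_Rintegral => //; first exact: integrable_norm dt.
  move=> x _; rewrite normrM mulrC ler_wpM2r // (le_trans (psiC t x)) //; lra.
rewrite RintegralZl //; last exact: integrable_norm di.
rewrite mulrC -ler_pdivlMr //; apply: le_trans ne; rewrite /Rintegral.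
exact: ler_norm.
Unshelve. all: by end_near. Qed.

(** On a finite measure constants are integrable, so by dominated convergence bounded pointwise
    limits are L^1 limits. *)
Lemma null_bounded_lim (f_ : nat -> 'rV[R]_d -> R) f K :
  (forall n, null (f_ n)) ->
  (forall n x, `|f_ n x| <= K) -> (forall x, f_ n x @[n --> \oo] --> f x) ->
  null f.
Proof.
move=> nf fK ff.
have mf n : measurable_fun setT (EFin \o f_ n) by have [/measurable_int] :=
  nf n.
have mlim : measurable_fun setT (EFin \o f).
  apply/measurable_EFinP; apply: (measurable_fun_cvg (h := f_)) => //.
  by move=> n; apply/measurable_EFinP.
have Ki : int (cst K) by exact: integrable_cst_fin.
have [] := @dominated_convergence _ _ _ nu _ measurableT (fun n => EFin \o f_ n)
  (EFin \o f) (EFin \o cst K) mf mlim _ Ki _.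
- by apply: aeW => x _; apply: cvg_EFin; [exact: nearW|exact: ff].
- by apply: aeW => x n _; rewrite lee_fin.
by move=> fi f0 _; apply: (null_L1_lim nf fi).
Qed.

Hypothesis null_Cc : forall g : 'rV[R]_d -> R, continuous g ->
  (forall x, 0 <= g x <= 1) ->
  (exists M, forall x, M < `|x| -> g x = 0) ->
    (\int[nu]_x (g x * psi e x)) @[e --> 0^'+] --> (0 : R).

Lemma null_positivity_set (c : 'rV[R]_d -> R) : continuous c ->
  null (\1_[set x | 0 < c x]).
Proof.
move=> cc.
(* The first factor of [chi n] cuts off at radius n, giving compact support; the second tends to 1
   where [c] is positive and vanishes elsewhere. *)
pose chi n (x : 'rV[R]_d) : R := Num.max 0 (Num.min 1 (n%:R - `|x|)) * Num.min 1
  (n%:R * Num.max 0 (c x)).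
have chi01 n x : 0 <= chi n x <= 1.
  have h1 : 0 <= Num.max 0 (Num.min 1 (n%:R - `|x|)) <= (1 : R).
    by rewrite le_max lexx ge_max ler01 ge_min lexx.
  have h2 : 0 <= Num.min 1 (n%:R * Num.max 0 (c x)) <= (1 : R).
    by rewrite le_min ler01 ge_min lexx mulr_ge0 // le_max lexx.
  rewrite /chi; move: h1 h2 => /andP[? ?] /andP[? ?]; rewrite mulr_ge0 //=.
  by rewrite mulr_ile1.
have cmax (f g : 'rV[R]_d -> R) : continuous f -> continuous g ->
    continuous (fun x => Num.max (f x) (g x)).
  by move=> cf cg x; exact: (continuous_max (cf x) (cg x)).
have cmin (f g : 'rV[R]_d -> R) : continuous f -> continuous g ->
    continuous (fun x => Num.min (f x) (g x)).
  by move=> cf cg x; exact: (continuous_min (cf x) (cg x)).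
have ccst (r : R) := @cst_continuous 'rV[R]_d R r.
have cchi n : continuous (chi n).
  have cn : continuous (fun x : 'rV[R]_d => n%:R - `|x| : R).
    by move=> x; exact: (cvgB (ccst n%:R x) (@norm_continuous _ _ x)).
  have ccn : continuous (fun x => n%:R * Num.max 0 (c x)).
    by move=> x; exact: (cvgM (ccst n%:R x) (cmax _ _ (ccst 0) cc x)).
  by move=> x; exact: (cvgM (cmax _ _ (ccst 0) (cmin _ _ (ccst 1) cn) x)
    (cmin _ _ (ccst 1) ccn x)).
apply: (@null_bounded_lim chi _ 1).
- move=> n; split.
    apply: (@le_integrable _ _ _ _ _ _ _ (EFin \o cst 1)) => //.
    + by apply/measurable_EFinP; exact: continuous_measurable_rV.
    + by move=> x _ /=; rewrite lee_fin normr1 ger0_norm;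
        case/andP: (chi01 n x).
    + exact: integrable_cst_fin.
  apply: null_Cc => //; exists n%:R => x nx.
  by rewrite /chi max_l ?mul0r // ge_min; apply/orP; right; lra.
- by move=> n x; case/andP: (chi01 n x) => ? ?; rewrite ger0_norm.
- move=> x; rewrite indicE.
  have [cx|cx] := ltP 0 (c x); last first.
    rewrite memNset /=; last by rewrite /= ltNge cx.
    rewrite (_ : (fun n => _) = cst 0); first exact: cvg_cst.
    by apply/funext => n;
      rewrite /chi (max_l cx) mulr0 (@min_r _ _ 1 0) ?mulr0 ?ler01.
  rewrite mem_set //=.
  (* At a point where [c] is positive both factors equal 1 once n is large. *)
  apply: cvg_near_cst.
  near=> n; rewrite /chi (max_r (ltW cx)).
  have h1 : 1 <= n%:R - `|x| by rewrite lerBrDr; near: n; exact: nbhs_infty_ger.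
  have h2 : 1 <= n%:R * c x.
    by rewrite -ler_pdivrMr //; near: n; exact: nbhs_infty_ger.
  by rewrite (min_l h1) (min_l h2) (max_r ler01) mulr1.
Unshelve. all: by end_near. Qed.

(** The half-spaces x_i > r are positivity sets of continuous functions and generate the
    sigma-algebra. Positivity sets are moreover stable under intersection, through the minimum of
    two functions, as a Dynkin argument requires. *)
Lemma rV_measurableE : @measurable _ 'rV[R]_d =
  <<s [set U | exists2 c : 'rV[R]_d -> R,
                 continuous c & U = [set x | 0 < c x]] >>.
Proof.
set G := (X in <<s X >>).
have GE (U : set 'rV[R]_d) : G U -> measurable U.
  move=> [c cc ->]; rewrite (_ : [set x | _] = c @^-1` `]0, +oo[%classic).
    rewrite -[X in measurable X]setTI; exact: (continuous_measurable_rV cc).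
  by apply/seteqP; split => x /=; rewrite in_itv /= andbT.
apply/seteqP; split; last by apply: smallest_sub => //;
  exact: sigma_algebra_measurable.
apply: smallest_sub; first exact: smallest_sigma_algebra.
move=> A; rewrite -bigcup_seq => -[i _ [B mB <-]].
pose T := g_sigma_algebraType G.
suff : measurable_fun setT ((fun x => x ord0 i) : T -> R) by apply.
apply: (measurability _ (RGenOInfty.measurableE R)) => _ [_ [r ->] <-].
rewrite setTI; apply: sub_sigma_algebra;
  exists (fun x : 'rV[R]_d => x ord0 i - r).
  by move=> x; exact: (cvgB (@coord_continuous _ _ _ ord0 i x)
    (@cst_continuous 'rV[R]_d R r x)).
by apply/seteqP; split => x /=; rewrite in_itv /= andbT subr_gt0.
Qed.

(** The sets with null indicator form a Dynkin class: complements follow from linearity, disjoint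
    countable unions from linearity and bounded limits. *)
Lemma null_indic A : measurable A -> null (\1_A).
Proof.
have nT : null \1_setT.
  rewrite [setT](_ : _ = [set x : 'rV[R]_d | 0 < (fun=> 1 : R) x]).
    by apply: null_positivity_set; exact: (@cst_continuous 'rV[R]_d R 1).
  by apply/seteqP; split => x //= _; exact: ltr01.
rewrite rV_measurableE; move: A; apply: dynkin_induction.
- exact: rV_measurableE.
- move=> _ _ [c cc ->] [c' cc' ->]; exists (fun x => Num.min (c x) (c' x)).
    by move=> x; exact: (continuous_min (cc x) (cc' x)).
  by apply/seteqP; split => x /=; rewrite lt_min => /andP.
- exact: nT.
- by move=> _ [c cc ->]; exact: null_positivity_set.
- move=> S mS nS.
  have := null_lin 1 (-1) nT nS; congr null; apply/funext => x.
  rewrite !indicE in_setT in_setC; case: (x \in S) => /=; ring.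
- move=> S mS tS nS.
  pose g n := \1_(\big[setU/set0]_(k < n) S k) : 'rV[R]_d -> R.
  apply: (@null_bounded_lim g _ 1).
  + elim=> [|n ih].
      rewrite /g big_ord0; have := null_lin 0 0 nT nT; congr null;
        apply/funext => x.
      by rewrite indic0 !mul0r addr0.
    rewrite /g big_ord_recr /=; have := null_lin 1 1 ih (nS n); congr null;
      apply/funext => x.
    rewrite !mul1r /g !indicE in_setU.
    have [xn|] := boolP (x \in S n); last by rewrite orbF addr0.
    (* By disjointness, a point of [S n] lies in no earlier [S k], so the indicators add up without
       overlap. *)
    have [xU|_] := boolP (x \in \big[setU/set0]_(k < n) S k);
      last by rewrite add0r.
    move: (set_mem xU).
    rewrite -bigcup_mkord => -[k /= kn Sk].
    move: tS => /trivIsetP /(_ k n Logic.I Logic.I).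
    rewrite ltn_eqF // => /(_ isT) kn0; have : (S k `&` S n) x :=
      conj Sk (set_mem xn).
    by rewrite kn0.
  + by move=> n x; rewrite /g indicE ger0_norm // lern1 leq_b1.
  + move=> x; rewrite indicE; have [/set_mem[k _ Sk]|/negP xS] :=
      boolP (x \in \bigcup_k S k).
      apply: cvg_near_cst; exists k.+1 => // n /= kn.
      by rewrite /g indicE mem_set // -bigcup_mkord; exists k.
    rewrite (_ : (fun n => _) = cst 0); first exact: cvg_cst.
    apply/funext => n; rewrite /g indicE memNset //= => h; apply: xS;
      apply/mem_set.
    by move: h; rewrite -bigcup_mkord => -[k _ Sk]; exists k.
Qed.

Import HBSimple.

Lemma weak_star_integrable f : int f ->
  (\int[nu]_x (f x * psi e x)) @[e --> 0^'+] --> (0 : R).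
Proof.
move=> fi; have [g [gi _ gf]] := approximation_sfun_integrable measurableT fi.
have ng n : null (g n).
  (* A simple function is a finite combination of the indicators of its level sets; listing its
     values lets linearity be applied by induction. *)
  have [s gE] : exists s : seq R,
      forall x, g n x = \sum_(r <- s) (r * \1_(g n @^-1` [set r]) x).
    by eexists => x; rewrite fimfunE fsbig_finite.
  rewrite (_ : (g n : _ -> _) =
    (fun x => \sum_(r <- s) (r * \1_(g n @^-1` [set r]) x))); last first.
    by apply/funext => x; exact: gE.
  elim: s {gE} => [|r s ih].
    have nT := null_indic measurableT.
    have := null_lin 0 0 nT nT; congr null; apply/funext => x.
    by rewrite big_nil !mul0r addr0.
  have nr : null \1_(g n @^-1` [set r]).
    by apply: null_indic; rewrite -[X in measurable X]setTI;
      exact: measurable_funP.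
  have := null_lin r 1 nr ih; congr null; apply/funext => x.
  by rewrite big_cons mul1r.
apply: (null_L1_lim ng fi _).2.
rewrite [X in X @ _](_ : _ = (fun n => \int[nu]_x `|(EFin \o f) x -
  (g n x)%:E|)%E) //.
by apply/funext => n; apply: eq_integral => x _; rewrite /= distrC.
Qed.

End weak_star.

(** * Shifts of the fast variables *)

Lemma index_allpairs (T1 T2 : eqType) (s : seq T1) (t : seq T2) x y :
  x \in s -> y \in t ->
  index (x, y) [seq (a, b) | a <- s, b <- t] =
    (index x s * size t + index y t)%N.
Proof.
move=> + yt; elim: s => //= a s ih; rewrite inE eq_sym.
rewrite index_cat; case: eqVneq => [<- _|ax /= xs].
  by rewrite map_f // index_map // => ? ? [].
rewrite ifF; last by apply/negP => /mapP[b _ [xa _]]; rewrite xa eqxx in ax.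
by rewrite size_map ih // mulSn addnA.
Qed.

(** [mxvec] reads a matrix row by row. The formula shows that entries of earlier rows in the same
    column come first, which is what triangularity of the slow shift rests on. *)
Lemma val_mxvec_index m n (i : 'I_m) (j : 'I_n) :
  mxvec_index i j = (i * n + j)%N :> nat.
Proof.
rewrite /mxvec_index /= /enum_rank [enum_rank_in]unlock /insubd insubT /=.
  by rewrite cardE index_mem mem_enum.
move=> _; rewrite enumT unlock /= /prod_enum index_allpairs ?mem_enum //.
by rewrite !index_enum_ord size_enum_ord.
Qed.

(** * Tonelli's theorem over the unit cube *)

Section fubini_cube.
Context {R : realType} {d n : nat}.
Variable K : 'rV[R]_d * 'rV[R]_n -> \bar R.
Local Open Scope ereal_scope.
Hypothesis mK : measurable_fun setT K.
Hypothesis K0 : forall p, 0 <= K p.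

(** Extension by zero off the cube, so that Tonelli's theorem can be applied on the whole product
    space. *)
Let Kc := K \_ [set p | unit_cube p.2].

Let mKc : measurable_fun setT Kc.
Proof.
apply/(measurable_restrictT _ _).1; last exact: measurable_funTS.
rewrite -[X in measurable X]setTI; apply: measurable_snd => //.
exact: measurable_unit_cube.
Qed.

Let Kc0 p : 0 <= Kc p.
Proof. exact: erestrict_ge0. Qed.

Let KcE x : \int[lebesgue_rV n]_(s in unit_cube) K (x, s) =
  \int[lebesgue_rV n]_s Kc (x, s).
Proof.
rewrite integral_mkcond; apply: eq_integral => s _.
by rewrite /Kc /patch.
Qed.

Lemma measurable_integral_cube :
  measurable_fun setT (fun x => \int[lebesgue_rV n]_(s in unit_cube) K (x, s)).
Proof.
under eq_fun do rewrite KcE.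
exact: (measurable_fun_fubini_tonelli_F Kc).
Qed.

Lemma fubini_tonelli_cube :
  \int[lebesgue_rV d]_x \int[lebesgue_rV n]_(s in unit_cube) K (x, s) =
  \int[lebesgue_rV n]_(s in unit_cube) \int[lebesgue_rV d]_x K (x, s).
Proof.
under eq_integral do rewrite KcE.
rewrite fubini_tonelli // [RHS]integral_mkcond; apply: eq_integral => s _.
rewrite /patch; case: ifPn => sc.
  by apply: eq_integral => x _; rewrite /Kc /patch ifT.
by apply: integral0_eq => x _; rewrite /Kc /patch ifF //; exact/negbTE.
Qed.

End fubini_cube.

(** * Decomposition of the shifted fast variables *)

Section scales.
Context {R : realType} {d N : nat}.
Implicit Types (eps : R) (x : 'rV[R]_d) (s : 'rV[R]_(N * d)).

Definition scales eps x : 'rV[R]_(N * d) :=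
  mxvec (\matrix_(k < N, j < d) (x ord0 j / eps ^+ k.+1)).

Definition macro_shift eps s : 'rV[R]_d :=
  \row_j \sum_(l < N) eps ^+ l.+1 * vec_mx s l j.

(** In row k of h(s) = [macro_shift eps s] divided by eps^(k+1), the term l = k is s_k itself. The
    terms l < k collected here carry negative powers of eps and are not small, but they involve only
    earlier rows of [s]. *)
Definition slow_shift eps s : 'rV[R]_(N * d) :=
  mxvec (\matrix_(k < N, j < d)
    ((\sum_(l < N | (l < k)%N) eps ^+ l.+1 * vec_mx s l j) / eps ^+ k.+1)).

(** The remaining terms l > k carry positive powers of eps, hence are O(eps) on the cube. *)
Definition fast_shift eps s : 'rV[R]_(N * d) :=
  mxvec (\matrix_(k < N, j < d)
    ((\sum_(l < N | (k < l)%N) eps ^+ l.+1 * vec_mx s l j) / eps ^+ k.+1)).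

Lemma scales_shift eps x s : eps != 0 ->
  scales eps (x + macro_shift eps s) =
  s + (scales eps x + slow_shift eps s) + fast_shift eps s.
Proof.
move=> e0; transitivity (mxvec (vec_mx s) + (scales eps x + slow_shift eps s) +
  fast_shift eps s); last by rewrite vec_mxK.
rewrite /scales /slow_shift /fast_shift -!linearD /=.
congr mxvec; apply/matrixP => k j; rewrite !mxE.
have ek0 : eps ^+ k.+1 != 0 by rewrite expf_neq0.
(* The sum is split into l = k, l < k and l > k; the diagonal term cancels its own denominator. *)
rewrite (bigD1 k) //= (bigID (fun l : 'I_N => (l < k)%N)) /=.
rewrite (eq_bigl (fun l : 'I_N => (l < k)%N)); last first.
  by move=> l; rewrite -val_eqE /= neq_ltn; case: ltngtP.
rewrite [X in _ + (_ + (_ + X))](eq_bigl (fun l : 'I_N => (k < l)%N));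
  last first.
  by move=> l; rewrite -val_eqE /= neq_ltn; case: ltngtP.
rewrite !mxE; field.
exact: ek0.
Qed.

Lemma triangular_slow_shift eps x :
  triangular (fun s => scales eps x + slow_shift eps s).
Proof.
move=> i; case/mxvec_indexP: i => k j y y' yy'.
rewrite !mxE !mxvecE !mxE; congr (_ + _ / _); apply: eq_bigr => l lk.
rewrite !mxE yy' // !val_mxvec_index ltn_add2r ltn_mul2r lk andbT.
(* The existence of [j] forces d > 0, so multiplication by d preserves the strict inequality between
   rows. *)
by case: j {yy'} => j /=; case: (d).
Qed.

Lemma norm_sum_ord_le (P : pred 'I_N) (t : 'I_N -> R) eps : 0 <= eps ->
  (forall l, P l -> 0 <= t l <= eps) ->
  `|\sum_(l < N | P l) t l| <= N%:R * eps.
Proof.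
move=> e0 te; rewrite (le_trans (ler_norm_sum _ _ _)) //.
rewrite (@le_trans _ _ (\sum_(l < N) eps)) //; last first.
  by rewrite sumr_const card_ord mulr_natl.
rewrite big_mkcond /=; apply: ler_sum => l _; case: ifP => // Pl.
by have /andP[t0 tle] := te _ Pl; rewrite ger0_norm.
Qed.

Lemma unit_cube_entry s k j : unit_cube s -> 0 <= vec_mx s k j <= 1.
Proof.
by move=> /(_ (mxvec_index k j)); rewrite mxE in_itv /= => /andP[-> /ltW].
Qed.

Lemma macro_shift_le eps s j : 0 < eps <= 1 -> unit_cube s ->
  `|macro_shift eps s ord0 j| <= N%:R * eps.
Proof.
move=> /andP[e0 e1] sc; rewrite mxE; apply: norm_sum_ord_le; first exact: ltW.
move=> l _; have /andP[s0 s1] := unit_cube_entry l j sc.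
rewrite mulr_ge0 ?exprn_ge0 ?(ltW e0) //=.
rewrite (@le_trans _ _ (eps ^+ l.+1)) // ?ler_piMr ?exprn_ge0 ?(ltW e0) //.
by rewrite exprS ler_piMr ?(ltW e0) // exprn_ile1 // ltW.
Qed.

Lemma fast_shift_le eps s i : 0 < eps <= 1 -> unit_cube s ->
  `|fast_shift eps s ord0 i| <= N%:R * eps.
Proof.
case/mxvec_indexP: i => k j /andP[e0 e1] sc; rewrite mxvecE mxE mulr_suml.
apply: norm_sum_ord_le; first exact: ltW.
move=> l kl; have /andP[s0 s1] := unit_cube_entry l j sc.
have -> : eps ^+ l.+1 * vec_mx s l j / eps ^+ k.+1 = eps ^+ (l - k) *
  vec_mx s l j.
  by rewrite mulrAC -expfB // subSS.
rewrite mulr_ge0 ?exprn_ge0 ?(ltW e0) //=.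
rewrite (@le_trans _ _ (eps ^+ (l - k))) // ?ler_piMr ?exprn_ge0 ?(ltW e0) //.
(* As k < l, the exponent is at least 1: one factor eps is extracted and the remaining power is
   bounded by 1. *)
rewrite -[(l - k)%N]prednK ?subn_gt0 //.
by rewrite exprS ler_piMr ?(ltW e0) // exprn_ile1 // ltW.
Qed.

Lemma measurable_scales eps : measurable_fun setT (scales eps).
Proof.
apply/measurable_fun_coorP => i; case/mxvec_indexP: i => k j.
under eq_fun do rewrite mxvecE mxE.
by apply: measurable_funM => //; exact: measurable_coor.
Qed.

Lemma measurable_slow_shift eps : measurable_fun setT (slow_shift eps).
Proof.
apply/measurable_fun_coorP => i; case/mxvec_indexP: i => k j.
under eq_fun do rewrite mxvecE mxE big_mkcond.
apply: measurable_funM => //; apply: measurable_sum => l.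
case: (_ < _)%N => //; apply: measurable_funM => //.
under eq_fun do rewrite mxE.
exact: measurable_coor.
Qed.

End scales.

(** * Uniform continuity of periodic test functions *)

Section uniform_continuity.
Context {R : realType} {d n : nat}.
Variable G : 'rV[R]_d * 'rV[R]_n -> R.
Hypothesis cG : continuous G.
Hypothesis perG :
  forall x y (z : 'rV[int]_n), G (x, y + map_mx intr z) = G (x, y).
Variable M : R.
Hypothesis suppG : forall (x : 'rV[R]_d) y i, M < `|x ord0 i| -> G (x, y) = 0.

(** Compactness of a box times the closed cube, in near-covering form, gives one delta for all base
    points there. Periodicity brings [y] into the cube, and for [x] outside the box both values
    vanish. *)
Lemma periodic_uniform_continuity (eta : R) : 0 < eta ->
  \forall delta \near 0^'+, forall (x h : 'rV[R]_d) (y r : 'rV[R]_n),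
    (forall i, `|h ord0 i| < delta) -> (forall i, `|r ord0 i| < delta) ->
    `|G (x + h, y + r) - G (x, y)| <= eta.
Proof.
move=> eta0.
(* The margin 1 beyond [M], with delta at most 1, ensures that [x + h] stays off the support when
   [x] is outside the box. *)
pose box := [set x : 'rV[R]_d |
  forall i, `[- (M + 1), M + 1]%classic (x ord0 i)].
pose cube := [set y : 'rV[R]_n | forall i, `[0, 1]%classic (y ord0 i)].
pose P (delta : R) (p : 'rV[R]_d * 'rV[R]_n) :=
  forall (h : 'rV[R]_d) (r : 'rV[R]_n),
    (forall i, `|h ord0 i| < delta) -> (forall i, `|r ord0 i| < delta) ->
    `|G (p.1 + h, p.2 + r) - G p| <= eta.
have cK : compact (box `*` cube).
  apply: compact_setX.
    by apply: (@rV_compact R d (fun=> `[- (M + 1), M + 1]%classic)) => i;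
      exact: segment_compact.
  by apply: (@rV_compact R n (fun=> `[0, 1]%classic)) => i;
    exact: segment_compact.
have : \forall delta \near 0^'+, box `*` cube `<=` P delta.
  move/compact_near_coveringP : cK; apply => p _.
  have /cvgrPdist_lt /(_ (eta / 2)) : G q @[q --> p] --> G p := @cG p.
  rewrite divr_gt0 // => /(_ isT).
  move=> /nbhs_ballP[e /= e0 eG].
  have e20 : 0 < e / 2 by rewrite divr_gt0.
  (* Near the centre [p], both [q] and its perturbation stay in the ball where [G] is within eta/2
     of [G p]. *)
  near=> q delta => h r hd rd.
  have de : delta < e / 2 by near: delta; exact: nbhs_right_lt.
  have pq : ball p (e / 2) q by near: q; apply/nbhs_ballP; exists (e / 2).
  have pq1 : ball p e q by apply: le_ball pq; lra.
  have pq2 : ball p e (q.1 + h, q.2 + r).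
    move: pq => [/= [_ pq1'] [_ pq2']]; split; split => //= i j.
      rewrite (_ : i = ord0); last by rewrite ord1.
      have := pq1' ord0 j; rewrite /ball /= mxE => pqj; have := hd j.
      rewrite opprD addrA => /= hj; rewrite (le_lt_trans (ler_normB _ _)) //;
        lra.
    rewrite (_ : i = ord0); last by rewrite ord1.
    have := pq2' ord0 j; rewrite /ball /= mxE => pqj; have := rd j.
    rewrite opprD addrA => /= hj; rewrite (le_lt_trans (ler_normB _ _)) //; lra.
  have /= h1 := eG _ pq1; have /= h2 := eG _ pq2.
  rewrite [X in `|X|](_ : _ = (G p - G q) - (G p - G (q.1 + h, q.2 + r)));
    last by ring.
  rewrite (le_trans (ler_normB _ _)) //; lra.
apply: filterS2 (nbhs_right_le (@ltr01 R)) => delta d1 Pd x h y r hd rd.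
have [[i Mi]|xM] := pselect (exists i, M + 1 < `|x ord0 i|).
  have Mx : M < `|x ord0 i| by move: Mi; lra.
  have Mxh : M < `|(x + h) ord0 i|.
    rewrite mxE; have := hd i; have := ler_normB (x ord0 i + h ord0 i)
      (h ord0 i).
    by rewrite addrK; lra.
  by rewrite (@suppG _ _ i Mx) (@suppG _ _ i Mxh) subrr normr0 ltW.
have xbox : box x.
  move=> i; rewrite /= in_itv /= -ler_norml leNgt; apply/negP => Mi.
  by apply: xM; exists i.
pose z : 'rV[int]_n := \row_i - Num.floor (y ord0 i).
have ycube : cube (y + map_mx intr z).
  move=> i; rewrite /= in_itv /= !mxE rmorphN /=.
  have := floor_itv (y ord0 i); rewrite intrD; lra.
have := Pd (x, y + map_mx intr z) (conj xbox ycube) h r hd rd.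
by rewrite /= addrAC !perG.
Unshelve. all: by end_near. Qed.

End uniform_continuity.

(** * Averaging of continuous test functions *)

Section averaging.
Context {R : realType} {d N : nat}.
Variables (G : 'rV[R]_d * 'rV[R]_(N * d) -> R) (M : R).
Hypothesis cG : continuous G.
Hypothesis perG :
  forall x y (z : 'rV[int]_(N * d)), G (x, y + map_mx intr z) = G (x, y).
Hypothesis suppG : forall (x : 'rV[R]_d) y i, M < `|x ord0 i| -> G (x, y) = 0.
Hypothesis G0 : forall p, 0 <= G p.
Hypothesis intG_fin :
  (\int[lebesgue_rV d]_x \int[lebesgue_rV (N * d)]_(u in unit_cube)
    (G (x, u))%:E < +oo)%E.

Let S := [set x : 'rV[R]_d | forall i, `[- (M + 1), M + 1]%classic (x ord0 i)].
Let m := lebesgue_rV d S.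

Let mS : measurable S.
Proof.
apply: (@measurable_rV_box _ _ (fun=> `[- (M + 1), M + 1]%classic)) => i.
exact: measurable_itv.
Qed.

Let m_fin : m \is a fin_num.
Proof.
rewrite /m (lebesgue_rV_box (A := fun=> `[- (M + 1), M + 1]%classic));
  last first.
  by move=> i; exact: measurable_itv.
apply: (big_ind (fun a : \bar R => a \is a fin_num)) => // [a b|i _].
  exact: fin_numM.
by rewrite lebesgue_measure_itv /=; case: ifP.
Qed.

Let notS x : ~ S x -> exists i, M + 1 < `|x ord0 i|.
Proof.
move=> Sx; apply: contrapT => h; apply: Sx => i.
rewrite /= in_itv /= -ler_norml leNgt.
by apply/negP => Mi; apply: h; exists i.
Qed.

Let suppS x y : ~ S x -> G (x, y) = 0.
Proof. by move=> /notS[i Mi]; apply: (@suppG _ _ i); lra. Qed.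

Let mG : measurable_fun setT G := continuous_measurable_rV_pair cG.

Let mGx x : measurable_fun setT (fun u => (G (x, u))%:E).
Proof. by apply/measurable_EFinP;
  exact: (measurableT_comp mG (measurable_pair1 x)). Qed.

Let q (eta : R) (x : 'rV[R]_d) := (eta * \1_S x)%:E.

Let mq eta : measurable_fun setT (q eta).
Proof. by apply/measurable_EFinP; apply: measurable_funM. Qed.

Let q0 eta x : 0 <= eta -> (0 <= q eta x)%E.
Proof. by move=> eta0; rewrite lee_fin mulr_ge0 // indicE. Qed.

Let int_q eta : 0 <= eta -> (\int[lebesgue_rV d]_x q eta x = eta%:E * m)%E.
Proof.
move=> eta0; rewrite /q; under eq_integral do rewrite EFinM.
rewrite ge0_integralZl_EFin //; first by rewrite integral_indic // setIT.
by apply/measurable_EFinP.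
Qed.

Let I eps := (\int[lebesgue_rV d]_x (G (x, scales eps x))%:E)%E.
Let L := (\int[lebesgue_rV d]_x
  \int[lebesgue_rV (N * d)]_(u in unit_cube) (G (x, u))%:E)%E.
(** The fast variables after translation by h(s), with the O(eps) part [fast_shift] dropped. *)
Let Y eps (x : 'rV[R]_d) (s : 'rV[R]_(N * d)) :=
  s + (scales eps x + slow_shift eps s).
Let J eps (s : 'rV[R]_(N * d)) :=
  (\int[lebesgue_rV d]_x (G (x, Y eps x s))%:E)%E.

Let mY eps :
  measurable_fun setT
    (fun p : 'rV[R]_d * 'rV[R]_(N * d) => (p.1, Y eps p.1 p.2)).
Proof.
apply: measurable_fun_pair; first exact: measurable_fst.
apply/measurable_fun_coorP => i; rewrite /Y; under eq_fun do rewrite 2!mxE.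
apply: measurable_funD.
  exact: (measurableT_comp (measurable_coor i) measurable_snd).
apply: measurable_funD.
  apply: (measurableT_comp (measurable_coor i)).
  exact: (measurableT_comp (measurable_scales eps) measurable_fst).
apply: (measurableT_comp (measurable_coor i)).
exact: (measurableT_comp (measurable_slow_shift eps) measurable_snd).
Qed.

Let mGY eps :
  measurable_fun setT
    (fun p : 'rV[R]_d * 'rV[R]_(N * d) => (G (p.1, Y eps p.1 p.2))%:E).
Proof. by apply/measurable_EFinP; exact: (measurableT_comp mG (mY eps)). Qed.

Let mGYx eps s : measurable_fun setT (fun x => (G (x, Y eps x s))%:E).
Proof. exact: (measurableT_comp (mGY eps) (measurable_pair2 s)). Qed.

Let mGscales eps : measurable_fun setT (fun x => (G (x, scales eps x))%:E).
Proof.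
apply/measurable_EFinP; apply: (measurableT_comp mG).
by apply: measurable_fun_pair => //; exact: measurable_scales.
Qed.

(** Averaging over [s] is exact for every eps, not only in the limit: after Tonelli, for fixed [x],
    the map from [s] to [Y eps x s] is a triangular shift of the torus and preserves the integral of
    G(x, .). *)
Let integral_J eps :
  (\int[lebesgue_rV (N * d)]_(s in unit_cube) J eps s)%E = L.
Proof.
rewrite /J -(fubini_tonelli_cube (K := fun p => (G (p.1, Y eps p.1 p.2))%:E))
  //; last first.
  by move=> p; rewrite lee_fin.
apply: eq_integral => x _.
apply: (ge0_integral_torus_shift (a := fun s => scales eps x + slow_shift eps s)
  (psi := fun u => (G (x, u))%:E)).
- apply/measurable_fun_coorP => i; under eq_fun do rewrite mxE.
  by apply: measurable_funD => //;
    exact: (measurableT_comp (measurable_coor i) (measurable_slow_shift eps)).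
- exact: triangular_slow_shift.
- exact: mGx.
- by move=> y; rewrite lee_fin.
- by move=> y z; rewrite perG.
Qed.

Let measurable_J eps : measurable_fun setT (J eps).
Proof.
apply: (measurable_fun_fubini_tonelli_G (fun p =>
  (G (p.1, Y eps p.1 p.2))%:E)) => //.
by move=> p; rewrite lee_fin.
Qed.

Let J0 eps s : (0 <= J eps s)%E.
Proof. by apply: integral_ge0 => x _; rewrite lee_fin. Qed.

Let I0 eps : (0 <= I eps)%E.
Proof. by apply: integral_ge0 => x _; rewrite lee_fin. Qed.

Let int_cube_cst (a : \bar R) :
  (\int[lebesgue_rV (N * d)]_(s in unit_cube) (cst a s) = a)%E.
Proof.
rewrite integral_cst; last exact: measurable_unit_cube.
by rewrite -[RHS]mule1; congr (_ * _)%E; exact: lebesgue_rV_unit_cube.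
Qed.

Let L_fin : L \is a fin_num.
Proof.
rewrite ge0_fin_numE //.
by apply: integral_ge0 => x _; apply: integral_ge0 => u _; rewrite lee_fin.
Qed.

(** For each [s] in the cube, [I eps] and [J eps s] differ by at most eta times [m]; integrating in
    [s] over a cube of volume 1 replaces [J] by [L]. Additive inequalities are used because [I eps]
    could a priori be infinite. *)
Let I_near_L (eta : R) : 0 < eta ->
  \forall eps \near 0^'+,
    (I eps <= L + eta%:E * m /\ L <= I eps + eta%:E * m)%E.
Proof.
move=> eta0.
have [delta [[Gd d1] d0]] := filter_ex (filterI (filterI
  (periodic_uniform_continuity cG perG suppG eta0) (nbhs_right_le (@ltr01 R)))
  (nbhs_right_gt (0 : R))).
(* The denominator [N.+1] is positive even when N = 0 and still yields N eps < delta. *)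
have dN : 0 < delta / N.+1%:R by rewrite divr_gt0.
near=> eps.
have e0 : 0 < eps by near: eps; exact: nbhs_right_gt.
have e1 : eps <= 1 by near: eps; exact: nbhs_right_le.
have e01 : 0 < eps <= 1 by rewrite e0.
have ed : N%:R * eps < delta.
  have h : eps < delta / N.+1%:R by near: eps; exact: nbhs_right_lt.
  move: h; rewrite ltr_pdivlMr // mulrC; apply: le_lt_trans.
  by rewrite ler_wpM2r ?ler_nat // ltW.
have le_abs (a b c : R) : `|a - b| <= c -> a <= b + c /\ b <= a + c.
  by rewrite ler_norml => /andP[? ?]; split; lra.
have step (s : 'rV[R]_(N * d)) : unit_cube s ->
    (I eps <= J eps s + eta%:E * m /\ J eps s <= I eps + eta%:E * m)%E.
  move=> sc.
  pose Gs x := G (x + macro_shift eps s, Y eps x s + fast_shift eps s).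
  have Gs0 x : 0 <= Gs x by exact: G0.
  (* By translation invariance, the shift by h(s) leaves the same integral [I eps] for every [s]. *)
  have IE : I eps = (\int[lebesgue_rV d]_x (Gs x)%:E)%E.
    rewrite /I -(ge0_integral_rV_shift (macro_shift eps s)) //; last first.
      by move=> x; rewrite lee_fin.
    by apply: eq_integral => x _; rewrite /Gs scales_shift // gt_eqF.
  have mGs : measurable_fun setT (EFin \o Gs).
    have := measurableT_comp (mGscales eps)
      (measurable_rV_shift (macro_shift eps s)).
    congr measurable_fun; apply/funext => x.
    by rewrite /= /Gs scales_shift // gt_eqF.
  have Gxs x : Gs x <= G (x, Y eps x s) + eta * \1_S x /\
      G (x, Y eps x s) <= Gs x + eta * \1_S x.
    have hd i : `|macro_shift eps s ord0 i| < delta by apply: le_lt_trans ed;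
      exact: macro_shift_le.
    have rd i : `|fast_shift eps s ord0 i| < delta by apply: le_lt_trans ed;
      exact: fast_shift_le.
    (* On [S] uniform continuity applies; off [S] both values vanish, since the shift is shorter
       than the margin 1. *)
    have [Sx|Sx] := pselect (S x).
      by rewrite indicE mem_set // mulr1; apply: le_abs; exact: Gd.
    rewrite indicE memNset // mulr0 !addr0 (suppS _ Sx).
    have [i Mi] := notS Sx.
    rewrite /Gs (@suppG _ _ i) //.
    rewrite mxE; have := hd i;
      have := ler_normB (x ord0 i + macro_shift eps s ord0 i)
        (macro_shift eps s ord0 i).
    by rewrite addrK; lra.
  have eta0' := ltW eta0.
  split; rewrite -int_q // IE /J -ge0_integralD //.
  - apply: ge0_le_integral => //.
    + by move=> x _; rewrite lee_fin.
    + exact: emeasurable_funD.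
    + by move=> x _; rewrite -EFinD lee_fin; case: (Gxs x).
  - by move=> x _; rewrite lee_fin.
  - by move=> x _; exact: q0.
  - apply: ge0_le_integral => //.
    + by move=> x _; rewrite lee_fin.
    + exact: emeasurable_funD.
    + by move=> x _; rewrite -EFinD lee_fin; case: (Gxs x).
  - by move=> x _; rewrite lee_fin.
  - by move=> x _; exact: q0.
have em0 : (0 <= eta%:E * m)%E by apply: mule_ge0;
  [rewrite lee_fin ltW|exact: measure_ge0].
have mJ : measurable_fun unit_cube (J eps) by exact: measurable_funTS.
have mJm : measurable_fun unit_cube (fun s => J eps s + eta%:E * m)%E.
  by apply: emeasurable_funD => //; exact: measurable_cst.
have JmE : (\int[lebesgue_rV (N * d)]_(s in unit_cube) (J eps s + eta%:E * m) =
  L + eta%:E * m)%E.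
  rewrite ge0_integralD;
    [|exact: measurable_unit_cube|by []|exact: mJ|by []|exact: measurable_cst].
  by congr (_ + _)%E; [exact: integral_J|exact: int_cube_cst].
split.
  rewrite -(int_cube_cst (I eps)) -JmE.
  apply: ge0_le_integral => //; first exact: measurable_unit_cube.
    by move=> s _; exact: I0.
  by move=> s /step[].
rewrite -(integral_J eps) -(int_cube_cst (I eps + eta%:E * m)%E).
apply: ge0_le_integral => //; first exact: measurable_unit_cube.
by move=> s /step[].
Unshelve. all: by end_near. Qed.

Lemma multiscale_averaging :
  (\int[lebesgue_rV d]_x (G (x, scales eps x))%:E)%E @[eps --> 0^'+] -->
  (\int[lebesgue_rV d]_x \int[lebesgue_rV (N * d)]_(u in unit_cube)
    (G (x, u))%:E)%E.
Proof.
rewrite -/L -(fineK L_fin).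
have m0 : 0 <= fine m by apply: fine_ge0; exact: measure_ge0.
(* The estimate with eta = 1 will give finiteness of [I eps] for small eps, so that convergence can
   be checked on real numbers. *)
have I_fin eps : (I eps <= L + 1 * m)%E -> I eps \is a fin_num.
  move=> h; rewrite (ge0_fin_numE (I0 eps)) (le_lt_trans h) // ltey_eq.
  by rewrite fin_numD L_fin mul1e m_fin.
apply/fine_cvgP; split.
  by near=> eps; apply: I_fin; near: eps; apply: filterS (I_near_L ltr01) =>
    eps [].
apply/cvgrPdist_le => e e0.
have m1 : 0 < fine m + 1 by lra.
have eta0 : 0 < e / (fine m + 1) by rewrite divr_gt0.
near=> eps.
have If : I eps \is a fin_num.
  by apply: I_fin; near: eps; apply: filterS (I_near_L ltr01) => eps [].
have [h1 h2] : (I eps <= L + (e / (fine m + 1))%:E * m /\ L <= I eps +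
  (e / (fine m + 1))%:E * m)%E.
  by near: eps; exact: I_near_L.
have em : e / (fine m + 1) * fine m <= e.
  by rewrite mulrAC ler_pdivrMr // ler_wpM2l ?ltW //; lra.
rewrite /= -/(I eps) ler_norml.
move: h1 h2; rewrite -(fineK If) -(fineK L_fin) -(fineK m_fin) -!EFinM -!EFinD
  !lee_fin.
lra.
Unshelve. all: by end_near. Qed.

End averaging.

(** * Densities *)

Section density.
Context d (T : measurableType d) (R : realType).
Variables (mu : {measure set T -> \bar R}) (p : T -> R).
Hypotheses (mp : measurable_fun setT p) (p0 : forall x, 0 <= p x).
Local Open Scope ereal_scope.

Import HBNNSimple.

Let nu : {measure set T -> \bar R} := density_measure mu p.

Let integral_density_nnsfun (g : {nnsfun T >-> R}) :
  \int[nu]_x (g x)%:E = \int[mu]_x ((g x)%:E * (p x)%:E).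
Proof.
have mg r : measurable (g @^-1` [set r]).
  by rewrite -[X in measurable X]setTI; exact: measurable_funP.
transitivity (\sum_(k \in range g) \int[nu]_x (k * \1_(g @^-1` [set k]) x)%:E).
  under eq_integral do rewrite fimfunE -fsumEFin//.
  rewrite ge0_integral_fsum//.
  - by move=> y; exact/measurable_EFinP/measurable_funM.
  - by move=> y x _; rewrite nnfun_muleindic_ge0.
transitivity (\sum_(k \in range g)
    \int[mu]_x ((k * \1_(g @^-1` [set k]) x)%:E * (p x)%:E)); last first.
  rewrite -ge0_integral_fsum//.
  - apply: eq_integral => x _; rewrite -ge0_mule_fsuml.
      by rewrite [in RHS]fimfunE -fsumEFin.
    by move=> y; rewrite EFinM nnfun_muleindic_ge0.
  - move=> y; apply: emeasurable_funM; last exact/measurable_EFinP.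
    by apply/measurable_EFinP/measurable_funM.
  - by move=> y x _;
      rewrite mule_ge0 ?lee_fin // -lee_fin EFinM nnfun_muleindic_ge0.
apply: eq_fsbigr => r; rewrite inE => -[x _ gxr].
have r0 : (0 <= r)%R by rewrite -gxr.
rewrite integralZl_indic_nnsfun// integral_indic// setIT.
rewrite [nu _](_ : _ = \int[mu]_(x in g @^-1` [set r]) (p x)%:E);
  last exact: density_measureE.
under [RHS]eq_integral do rewrite EFinM -muleA.
rewrite ge0_integralZl_EFin//; first last.
- by apply: emeasurable_funM; exact/measurable_EFinP.
- by move=> y _; rewrite mule_ge0 ?lee_fin.
congr (_ * _); rewrite integral_mkcond; apply: eq_integral => y _.
by rewrite /patch indicE; case: (y \in _); rewrite ?mul1e ?mul0e.
Qed.

(** The identity holds for simple functions, level set by level set, and extends by monotone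
    convergence; nonnegativity of [p] keeps the products increasing. *)
Lemma ge0_integral_density (f : T -> \bar R) :
  measurable_fun setT f -> (forall x, 0 <= f x) ->
  \int[nu]_x f x = \int[mu]_x (f x * (p x)%:E).
Proof.
move=> mf f0; pose g := nnsfun_approx measurableT mf.
have gf x : EFin \o g ^~ x @ \oo --> f x by exact: cvg_nnsfun_approx.
transitivity (limn (fun n => \int[nu]_x (g n x)%:E)).
  rewrite -monotone_convergence//.
  - by apply: eq_integral => x _; apply/esym/cvg_lim => //; exact: gf.
  - by move=> n; exact/measurable_EFinP.
  - by move=> n x _; rewrite lee_fin.
  - by move=> x _ a b ab; rewrite lee_fin; exact/lefP/nd_nnsfun_approx.
rewrite (_ : (fun n => _) = (fun n => \int[mu]_x ((g n x)%:E * (p x)%:E)));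
  last first.
  by apply/funext => n; exact: integral_density_nnsfun.
rewrite -monotone_convergence//.
- apply: eq_integral => x _; apply/cvg_lim => //.
  exact: cvgeZr (gf x).
- by move=> n; apply: emeasurable_funM; exact/measurable_EFinP.
- by move=> n x _; rewrite mule_ge0 ?lee_fin.
- move=> x _ a b ab; rewrite lee_wpmul2r ?lee_fin //;
    exact/lefP/nd_nnsfun_approx.
Qed.

Lemma integral_density (f : T -> R) : measurable_fun setT f ->
  \int[nu]_x (f x)%:E = \int[mu]_x (f x * p x)%:E.
Proof.
move=> mf; have mfE : measurable_fun setT (EFin \o f) by exact/measurable_EFinP.
rewrite integralE [RHS]integralE.
rewrite ge0_integral_density //; last exact: measurable_funepos.
rewrite ge0_integral_density //; last exact: measurable_funeneg.
(* As [p] is nonnegative, taking positive or negative parts commutes with multiplication by [p]. *)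
congr (_ - _); apply: eq_integral => x _.
  by rewrite !funeposE -!EFin_max -EFinM maxr_pMl // mul0r.
by rewrite !funenegE /= -!EFin_max -EFinM maxr_pMl // mul0r mulNr.
Qed.

Lemma integrable_density (f : T -> R) : measurable_fun setT f ->
  nu.-integrable setT (EFin \o f) ->
    mu.-integrable setT (fun x => (f x * p x)%:E).
Proof.
move=> mf /integrableP[_ fi]; apply/integrableP; split.
  by apply/measurable_EFinP; exact: measurable_funM.
apply: le_lt_trans fi.
rewrite (@integral_density (fun x => `|f x|)%R); last exact: measurableT_comp.
by under eq_integral => x _ do rewrite abse_EFin normrM (ger0_norm (p0 x)).
Qed.

End density.

(** * Expectations under reweighted probability measures *)

Section weights.
Context {R : realType} {d : nat}.
Local Notation Leb := (lebesgue_rV d).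
Variable w : 'rV[R]_d -> R.
Hypothesis mw : measurable_fun setT w.
Hypothesis w0 : forall x, 0 < w x.
Hypothesis iw : Leb.-integrable setT (EFin \o w).

(** A zero integral would make [w] vanish almost everywhere; as [w] is positive everywhere, the
    exceptional null set would contain the unit cube, which has measure 1. *)
Lemma Rintegral_rV_gt0 : 0 < \int[Leb]_x w x.
Proof.
rewrite lt_neqAle Rintegral_ge0 ?andbT => [|x _]; last exact: ltW.
apply/negP => /eqP/esym w_eq0.
have : (\int[Leb]_x `|(EFin \o w) x| = 0)%E.
  under eq_integral => x _ do rewrite /= gtr0_norm//.
  by rewrite -[LHS]fineK ?integrable_fin_num//; congr EFin.
move/(ae_eq_integral_abs _ measurableT (measurable_int _ iw)) => [A [mA A0 sA]].
have : (Leb (@unit_cube R d) <= Leb A)%E.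
  apply: le_measure; rewrite ?inE //; first exact: measurable_unit_cube.
  by move=> x _; apply: sA => /= /(_ Logic.I) [] /eqP; rewrite gt_eqF.
by rewrite A0 lebesgue_rV_unit_cube lee_fin ler10.
Qed.

Local Notation Z := (\int[Leb]_x w x).
Let Z0 : 0 < Z := Rintegral_rV_gt0.

Let mwZ : measurable_fun setT (fun x => w x / Z).
Proof. by apply: measurable_funM. Qed.

Let wZ0 x : 0 <= w x / Z. Proof. by rewrite divr_ge0 ?ltW. Qed.

Let nu : {measure set 'rV[R]_d -> \bar R} := prob_of_weight w.

Lemma prob_of_weight_fin_num : nu setT \is a fin_num.
Proof.
by rewrite [nu setT](prob_of_weight_setT mw (fun x => ltW (w0 x)) iw Z0).
Qed.

Variables (phi : 'rV[R]_d -> R) (c C : R).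
Hypothesis mphi : measurable_fun setT phi.
Hypothesis c0 : 0 < c.
Hypothesis phicC : forall x, c <= phi x <= C.

Let phi0 x : 0 < phi x. Proof. by case/andP: (phicC x) => + _;
  exact: lt_le_trans. Qed.
Let phiC x : phi x <= C. Proof. by case/andP: (phicC x). Qed.

Lemma integrable_mul_weight : Leb.-integrable setT
  (EFin \o (fun x => w x * phi x)).
Proof.
apply: (@le_integrable _ _ _ _ _ _ _ (fun x => C%:E * (w x)%:E)%E) => //.
- by apply/measurable_EFinP; exact: measurable_funM.
- move=> x _ /=; rewrite lee_fin !normrM mulrC ler_wpM2r //.
  by rewrite gtr0_norm // (le_trans (phiC x)) // ler_norm.
- exact: integrableZl.
Qed.

Let A := \int[Leb]_x (w x * phi x).

Let A_gt0 : 0 < A.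
Proof.
apply: (@lt_le_trans _ _ (\int[Leb]_x (c * w x))).
  by rewrite RintegralZl // mulr_gt0.
apply: le_Rintegral => //.
- exact: (integrableZl measurableT c iw).
- exact: integrable_mul_weight.
- by move=> x _; rewrite mulrC ler_pM2l //; case/andP: (phicC x).
Qed.

Let Z_neq0 : Z != 0. Proof. by rewrite gt_eqF. Qed.

Let Rintegral_nu_phi : \int[nu]_x phi x = A / Z.
Proof.
rewrite [RHS]mulrC -RintegralZl //; last exact: integrable_mul_weight.
rewrite /Rintegral /nu integral_density //; congr fine.
by apply: eq_integral => x _; congr EFin; rewrite -/(Rintegral Leb setT w);
  field.
Qed.

Lemma Rintegral_prob_of_weight_gt0 : 0 < \int[nu]_x phi x.
Proof. by rewrite Rintegral_nu_phi divr_gt0. Qed.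

(** The normalisation [Z] cancels in the quotient. Every reweighted expectation is thus a quotient
    of integrals against one fixed measure, and varying [phi] only changes the integrands. *)
Lemma integral_prob_of_weight_mul (f : 'rV[R]_d -> R) :
  nu.-integrable setT (EFin \o f) ->
  (\int[prob_of_weight (fun x => w x * phi x)%R]_x (f x)%:E =
   ((\int[nu]_x (f x * phi x)) / (\int[nu]_x phi x))%:E)%E.
Proof.
move=> fi; have mf : measurable_fun setT f.
  by apply/measurable_EFinP; exact: measurable_int fi.
have fphi_int : Leb.-integrable setT (fun x => (f x * phi x * (w x / Z))%:E).
  apply: integrable_density => //; first exact: measurable_funM.
  apply: (@le_integrable _ _ _ _ _ _ _ (fun x => C%:E * (f x)%:E)%E) => //.
  - by apply/measurable_EFinP; exact: measurable_funM.
  - move=> x _ /=; rewrite lee_fin !normrM mulrC ler_wpM2r //.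
    by rewrite gtr0_norm // (le_trans (phiC x)) // ler_norm.
  - exact: integrableZl.
rewrite Rintegral_nu_phi invf_div mulrC /prob_of_weight integral_density //;
  last 2 first.
- by apply: measurable_funM => //; exact: measurable_funM.
- by move=> x; rewrite divr_ge0 ?mulr_ge0 ?ltW.
rewrite -/A /Rintegral /nu [in RHS]integral_density //;
  last exact: measurable_funM.
rewrite EFinM fineK; last exact: integrable_fin_num.
rewrite -integralZl //; apply: eq_integral => x _; rewrite -EFinM; congr EFin.
by rewrite -/(Rintegral Leb setT w); field; rewrite Z_neq0 gt_eqF.
Qed.

End weights.

(** * Weak convergence of the oscillating weights *)

Lemma coor_le_norm {R : realType} n (x : 'rV[R]_n) i : `|x ord0 i| <= `|x|.
Proof.
rewrite [leRHS]/Num.Def.normr /= mx_normrE; apply/bigmax_geP; right => /=.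
by exists (ord0, i).
Qed.

Section torus_average.
Context {R : realType} {d N : nat}.
Local Notation Leb := (lebesgue_rV d).
Local Notation cube := (@unit_cube R (N * d)).
Variables (phi : 'rV[R]_d * 'rV[R]_(N * d) -> R) (c C : R).
Hypothesis cphi : continuous phi.
Hypothesis c0 : 0 < c.
Hypothesis phicC : forall p, c <= phi p <= C.
Hypothesis per :
  forall x y (z : 'rV[int]_(N * d)), phi (x, y + map_mx intr z) = phi (x, y).

Let mphi : measurable_fun setT phi := continuous_measurable_rV_pair cphi.
Let phi0 p : 0 <= phi p.
Proof. by case/andP: (phicC p) => + _; apply: le_trans; exact: ltW. Qed.

Definition torus_average (x : 'rV[R]_d) : R :=
  \int[lebesgue_rV (N * d)]_(u in cube) phi (x, u).

Let mphi1 x : measurable_fun setT (fun u => phi (x, u)).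
Proof. exact: (measurableT_comp mphi (measurable_pair1 x)). Qed.

Let cube_fin : (lebesgue_rV (N * d) cube \is a fin_num)%E.
Proof. by rewrite lebesgue_rV_unit_cube. Qed.

Let int_cst (a : R) :
  (lebesgue_rV (N * d)).-integrable cube (EFin \o cst a) /\
  (\int[lebesgue_rV (N * d)]_(u in cube) (cst a%:E u) = a%:E)%E.
Proof.
have mcube := @measurable_unit_cube R (N * d).
split; first exact: integrable_cst_fin.
rewrite integral_cst // -[RHS]mule1; congr (_ * _)%E.
exact: lebesgue_rV_unit_cube.
Qed.

Lemma integrable_torus x :
  (lebesgue_rV (N * d)).-integrable cube (fun u => (phi (x, u))%:E).
Proof.
apply: (le_integrable _ _ _ (int_cst C).1).
- exact: measurable_unit_cube.
- by apply: measurable_funTS; apply/measurable_EFinP; exact: mphi1.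
- move=> u _; rewrite /= lee_fin ger0_norm //; case/andP: (phicC (x, u)) => _ h.
  by rewrite (le_trans h) // ler_norm.
Qed.

Lemma torus_averageE x :
  (\int[lebesgue_rV (N * d)]_(u in cube) (phi (x, u))%:E =
    (torus_average x)%:E)%E.
Proof.
rewrite /torus_average /Rintegral fineK //; apply: integrable_fin_num.
  exact: measurable_unit_cube.
exact: integrable_torus.
Qed.

Lemma torus_average_bounds x : c <= torus_average x <= C.
Proof.
rewrite -!lee_fin -torus_averageE -{1}(int_cst c).2 -(int_cst C).2; apply/andP;
  split.
- apply: le_integral;
    [exact: measurable_unit_cube|exact: (int_cst c).1|exact: integrable_torus|].
  by move=> u _; rewrite lee_fin; case/andP: (phicC (x, u)).
- apply: le_integral;
    [exact: measurable_unit_cube|exact: integrable_torus|exact: (int_cst C).1|].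
  by move=> u _; rewrite lee_fin; case/andP: (phicC (x, u)).
Qed.

Lemma measurable_torus_average : measurable_fun setT torus_average.
Proof.
apply/measurable_EFinP;
  rewrite (_ : EFin \o _ = (fun x => \int[lebesgue_rV (N * d)]_(u in cube)
    (phi (x, u))%:E)%E).
  apply: (measurable_integral_cube (K := fun p => (phi p)%:E)) => [|p];
    last by rewrite lee_fin.
  exact/measurable_EFinP.
by apply/funext => x; rewrite torus_averageE.
Qed.

Variable w : 'rV[R]_d -> R.
Hypothesis cw : continuous w.
Hypothesis w0 : forall x, 0 < w x.
Hypothesis iw : Leb.-integrable setT (EFin \o w).

Let nu : {measure set 'rV[R]_d -> \bar R} := prob_of_weight w.
Let psi eps x := phi (x, scales eps x).
Let mw : measurable_fun setT w := continuous_measurable_rV cw.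
Let Z0 : 0 < \int[Leb]_x w x. Proof. exact: Rintegral_rV_gt0. Qed.

Let mpsi eps : measurable_fun setT (psi eps).
Proof.
apply: (measurableT_comp mphi).
by apply: measurable_fun_pair => //; exact: measurable_scales.
Qed.

Let integrable_mul (g h : 'rV[R]_d -> R) : nu.-integrable setT (EFin \o g) ->
  measurable_fun setT h -> (forall x, c <= h x <= C) ->
  nu.-integrable setT (EFin \o (fun x => g x * h x)).
Proof.
move=> gi mh hC;
  apply: (@le_integrable _ _ _ _ _ _ _ (fun x => C%:E * (g x)%:E)%E) => //.
- apply/measurable_EFinP; apply: measurable_funM => //.
  by apply/measurable_EFinP; exact: measurable_int gi.
- move=> x _ /=; rewrite lee_fin !normrM mulrC ler_wpM2r //.
  case/andP: (hC x) => ch Ch; rewrite ger0_norm ?(le_trans Ch) ?ler_norm //.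
  exact: le_trans (ltW c0) ch.
- exact: integrableZl.
Qed.

Let nu_fin : nu setT \is a fin_num := prob_of_weight_fin_num mw w0 iw.

Let integrable_bounded (g : 'rV[R]_d -> R) :
  measurable_fun setT g -> (forall x, 0 <= g x <= 1) ->
  nu.-integrable setT (EFin \o g).
Proof.
move=> mg g01;
  apply: (le_integrable _ _ _ (integrable_cst_fin 1 measurableT nu_fin)) => //.
  exact/measurable_EFinP.
by move=> x _; rewrite /= lee_fin normr1; case/andP: (g01 x) => ? ?;
  rewrite ger0_norm.
Qed.

(** The density of [nu] is absorbed into the test function: the product of [g], the normalised [w]
    and [phi] is continuous, periodic in the fast variables and compactly supported in x, so
    averaging against Lebesgue measure applies. *)
Let averaging_Cc (g : 'rV[R]_d -> R) :
  continuous g -> (forall x, 0 <= g x <= 1) ->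
  (exists M, forall x, M < `|x| -> g x = 0) ->
  (\int[nu]_x (g x * (psi eps x - torus_average x))) @[eps --> 0^'+] -->
    (0 : R).
Proof.
move=> cg g01 [M gM].
have mg := continuous_measurable_rV cg.
have g0 x : 0 <= g x by case/andP: (g01 x).
have gi := integrable_bounded mg g01.
have gpsi eps := integrable_mul gi (mpsi eps) (fun x =>
  phicC (x, scales eps x)).
have gavg := integrable_mul gi measurable_torus_average torus_average_bounds.
pose h x := g x * (w x / \int[Leb]_y w y).
have wZ0 x : 0 <= w x / \int[Leb]_y w y by apply: divr_ge0; exact: ltW.
have h0 x : 0 <= h x by exact: mulr_ge0.
have ch : continuous h.
  move=> x; exact: (cvgM (cg x)
    (cvgM (@cw x) (@cst_continuous 'rV[R]_d R (\int[Leb]_y w y)^-1 x))).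
pose G (p : 'rV[R]_d * 'rV[R]_(N * d)) := h p.1 * phi p.
have cG : continuous G.
  move=> p; have hp : {for p, continuous (h \o fst)}.
    by apply: continuous_comp; [exact: cvg_fst|exact: ch].
  exact: (cvgM hp (@cphi p)).
have G0 p : 0 <= G p by rewrite mulr_ge0.
have perG x y (z : 'rV[int]_(N * d)) : G (x, y + map_mx intr z) = G (x, y).
  by rewrite /G /= per.
have suppG (x : 'rV[R]_d) y i : M < `|x ord0 i| -> G (x, y) = 0.
  by move=> Mx; rewrite /G /h /= gM ?mul0r // (lt_le_trans Mx) // coor_le_norm.
have wZm : measurable_fun setT (fun x => w x / \int[Leb]_y w y)
  by apply: measurable_funM.
have nuE k : measurable_fun setT k ->
    (\int[nu]_x (k x)%:E = \int[Leb]_x (k x * (w x / \int[Leb]_y w y))%:E)%E.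
  by move=> mk; exact: integral_density.
have RE k : nu.-integrable setT (EFin \o k) ->
  ((\int[nu]_x k x)%:E = \int[nu]_x (k x)%:E)%E.
  by move=> ki; rewrite /Rintegral fineK //; exact: (integrable_fin_num _ ki).
have GE eps : (\int[Leb]_x (G (x, scales eps x))%:E =
  (\int[nu]_x (g x * psi eps x))%:E)%E.
  rewrite RE; last exact: gpsi.
  rewrite nuE; last by apply: measurable_funM.
  by apply: eq_integral => x _; congr EFin; rewrite /G /h /psi /=; ring.
have GE0 : (\int[Leb]_x \int[lebesgue_rV (N * d)]_(u in cube) (G (x, u))%:E =
  (\int[nu]_x (g x * torus_average x))%:E)%E.
  rewrite RE // nuE; last by apply: measurable_funM => //;
    exact: measurable_torus_average.
  apply: eq_integral => x _; rewrite /G /=.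
  under eq_integral => u _ do rewrite EFinM.
  rewrite integralZl; [|exact: measurable_unit_cube|exact: integrable_torus].
  by rewrite [X in (_ * X)%E]torus_averageE -EFinM; congr EFin; rewrite /h;
    ring.
(* [GE0] identifies the limit with a real number, which supplies the finiteness hypothesis and lets
   the convergence be read in R. *)
have := multiscale_averaging cG perG suppG G0.
rewrite GE0 ltry => /(_ isT); under eq_fun do rewrite GE.
move=> /fine_cvgP[_] /= cvgG.
rewrite (_ : (fun eps => _) = (fun eps => \int[nu]_x (g x * psi eps x) -
  \int[nu]_x (g x * torus_average x))); last first.
  apply/funext => eps; rewrite -RintegralB //; apply: eq_Rintegral => x _; ring.
by apply/subr_cvg0.
Qed.

Lemma weak_averaging (f : 'rV[R]_d -> R) :
  nu.-integrable setT (EFin \o f) ->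
  (\int[nu]_x (f x * phi (x, scales eps x))) @[eps --> 0^'+] -->
  (\int[nu]_x (f x * torus_average x)).
Proof.
move=> fi.
have fpsi eps := integrable_mul fi (mpsi eps) (fun x =>
  phicC (x, scales eps x)).
have favg := integrable_mul fi measurable_torus_average torus_average_bounds.
have mdiff eps : measurable_fun setT (fun x => psi eps x - torus_average x).
  by apply: measurable_funB => //; exact: measurable_torus_average.
(* Both terms lie in [c, C] with c > 0, so C itself bounds the difference. *)
have diffC eps x : `|psi eps x - torus_average x| <= C.
  have /andP[h1 h2] := phicC (x, scales eps x); have /andP[h3 h4] :=
    torus_average_bounds x.
  rewrite /psi ler_norml; move: c0 h1 h2 h3 h4;
    move: (phi _) (torus_average x) => a b; lra.
have := weak_star_integrable nu_fin mdiff diffC averaging_Cc fi.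
rewrite (_ : (fun eps => _) = (fun eps => \int[nu]_x (f x * psi eps x) -
  \int[nu]_x (f x * torus_average x))); last first.
  apply/funext => eps; rewrite -RintegralB //; apply: eq_Rintegral => x _; ring.
by move/subr_cvg0.
Qed.

End torus_average.

Lemma vec_mx_continuous (R : realType) m n : continuous (@vec_mx R m n).
Proof.
move=> u; apply: (cvg_mx_coor (nbhs_filter u)) => i j.
under eq_fun do rewrite mxE.
by rewrite mxE; exact: coord_continuous.
Qed.

Theorem proposition2p8 (R : realType) (d N : nat) (sigma : R)
    (V0 : 'rV[R]_d -> R) (V1 V : 'rV[R]_d * 'M[R]_(N, d) -> R)
    (d_ge1 : (1 <= d)%N) (N_ge1 : (1 <= N)%N) (sigma_gt0 : 0 < sigma)
    (V_smooth : smooth V) (V_per : torus_periodic V)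
    (V_decomp : forall x y, V (x, y) = V0 x + V1 (x, y))
    (V0_smooth : smooth V0) (V0_confining : confining V0 sigma)
    (V0_hessian : finite_norm (lebesgue_rV d) +oo%E (fun x => `|hessian V0 x|))
    (V1_smooth : smooth V1) (V1_per : torus_periodic V1)
    (V1_bounded : [bounded V1 p | p in setT])
    (f : 'rV[R]_d -> R) (f_L2 : f \in Lfun (pi_ref V0 sigma) 2%:E) :
  (\int[pi_eps V sigma eps]_x (f x)%:E @[eps --> 0^'+] -->
    \int[pi_zero V sigma]_x (f x)%:E)%E.
Proof.
pose w x := expR (- V0 x / sigma).
pose phi (p : 'rV[R]_d * 'rV[R]_(N * d)) :=
  expR (- V1 (p.1, vec_mx p.2) / sigma).
have [B V1B] : exists B, forall p, `|V1 p| <= B.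
  have [B [_ hB]] := V1_bounded; exists (B + 1) => p.
  by apply: (hB (B + 1)) => //; rewrite ltrDl.
have cV0 : continuous V0 := V0_smooth 0%N.
have cV1 : continuous V1 := V1_smooth 0%N.
have cgibbs (T : topologicalType) (U : T -> R) : continuous U ->
  continuous (fun x => expR (- U x / sigma)).
  move=> cU x; apply: (continuous_comp (f := fun x => - U x / sigma)
    (g := expR)); last exact: continuous_expR.
  exact: (cvgM (cvgN (cU x)) (@cst_continuous T R sigma^-1 x)).
have cw : continuous w by exact: cgibbs.
have w0 x : 0 < w x by exact: expR_gt0.
have iw : (lebesgue_rV d).-integrable setT (EFin \o w) by case: V0_confining.
have cphi : continuous phi.
  apply: (cgibbs _ (fun p : 'rV[R]_d * 'rV[R]_(N * d) =>
    V1 (p.1, vec_mx p.2))) => p.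
  apply: (continuous_comp (f := fun p : 'rV[R]_d * 'rV[R]_(N * d) =>
    (p.1, vec_mx p.2)) (g := V1)); last exact: cV1.
  have h2 : {for p, continuous (fun p : 'rV[R]_d * 'rV[R]_(N * d) =>
    vec_mx p.2)}.
    by apply: (continuous_comp (f := snd));
      [exact: cvg_snd|exact: vec_mx_continuous].
  exact: (cvg_pair (@cvg_fst _ _ _ _ _) h2).
have phi_per x y (z : 'rV[int]_(N * d)) : phi (x, y + map_mx intr z) =
  phi (x, y).
  by rewrite /phi /= linearD /= -(map_vec_mx intr z) V1_per.
have phiB p : expR (- B / sigma) <= phi p <= expR (B / sigma).
  have := V1B (p.1, vec_mx p.2); rewrite ler_norml => /andP[h1 h2].
  by rewrite !ler_expR !ler_pM2r ?invr_gt0 // lerN2 h2 lerNl h1.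
(* The reference measure is finite, so L^2 is contained in L^1. *)
have fi : (pi_ref V0 sigma).-integrable setT (EFin \o f).
  apply/Lfun1_integrable; apply: Lfun_subset12 f_L2.
  exact: (prob_of_weight_fin_num (continuous_measurable_rV cw) w0 iw).
have mw := continuous_measurable_rV cw.
have mphis eps : measurable_fun setT (fun x => phi (x, scales eps x)).
  apply: (measurableT_comp (continuous_measurable_rV_pair cphi)).
  by apply: measurable_fun_pair => //; exact: measurable_scales.
(* The splitting of V into V0 and V1 factors the weight into that of the reference measure times
   [phi] along the scales. *)
have epsE eps : (\int[pi_eps V sigma eps]_x (f x)%:E =
    ((\int[pi_ref V0 sigma]_x (f x * phi (x, scales eps x))) /
     (\int[pi_ref V0 sigma]_x phi (x, scales eps x)))%:E)%E.
  rewrite /pi_eps (_ : (fun x => _) = (fun x => w x * phi (x, scales eps x))).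
    exact: (integral_prob_of_weight_mul mw w0 iw (mphis eps) (expR_gt0 _)
      (fun x => phiB (x, scales eps x)) fi).
  apply/funext => x.
  by rewrite /multiscale /phi /scales /= mxvecK V_decomp opprD mulrDl expRD.
have avgB := torus_average_bounds cphi (expR_gt0 _) phiB.
have mavg := measurable_torus_average cphi (expR_gt0 _) phiB.
have zeroE : (\int[pi_zero V sigma]_x (f x)%:E =
    ((\int[pi_ref V0 sigma]_x (f x * torus_average phi x)) /
     (\int[pi_ref V0 sigma]_x torus_average phi x))%:E)%E.
  rewrite /pi_zero (_ : torus_weight V sigma =
    (fun x => w x * torus_average phi x)).
    exact: (integral_prob_of_weight_mul mw w0 iw mavg (expR_gt0 _) avgB fi).
  (* The factor coming from V0 does not depend on the torus variables and leaves the integral. *)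
  apply/funext => x; rewrite /torus_average -RintegralZl.
  - by apply: eq_Rintegral => u _; rewrite V_decomp opprD mulrDl expRD.
  - exact: measurable_unit_cube.
  - exact: (integrable_torus cphi (expR_gt0 _) phiB).
have avg_gt0 : 0 < \int[pi_ref V0 sigma]_x torus_average phi x.
  exact: (Rintegral_prob_of_weight_gt0 mw w0 iw mavg (expR_gt0 _) avgB).
under eq_fun do rewrite epsE.
rewrite zeroE; apply: cvg_EFin; first exact: nearW.
apply: cvgM.
  exact: (weak_averaging cphi (expR_gt0 _) phiB phi_per cw w0 iw fi).
apply: cvgV; first by rewrite gt_eqF.
(* Convergence of the denominators is the case f = 1 of the weak averaging. *)
have ones : (pi_ref V0 sigma).-integrable setT (EFin \o cst 1).
  apply: integrable_cst_fin => //; exact: (prob_of_weight_fin_num mw w0 iw).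
have := weak_averaging cphi (expR_gt0 _) phiB phi_per cw w0 iw ones.
under eq_fun do under eq_Rintegral do rewrite mul1r.
by under eq_Rintegral do rewrite mul1r.
Qed.
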